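(* For each $L\in\{\mathsf{MN},\mathsf{MNF}\}$ there exists a $\Sigma_1$ provability predicate $\mathrm{Pr}_T(x)$ of $T$ satisfying condition $\mathbf{M}$ such that: (1) for every modal formula $A$ and every arithmetical interpretation $f$ based on $\mathrm{Pr}_T(x)$, if $L\vdash A$ then $\mathsf{PA}\vdash f(A)$; and (2) there exists an arithmetical interpretation $f$ based on $\mathrm{Pr}_T(x)$ such that for every modal formula $A$, $L\vdash A$ if and only if $T\vdash f(A)$.
   Context: $T$ is a primitive recursively axiomatized consistent extension of Peano Arithmetic $\mathsf{PA}$ in the language of first-order arithmetic; $\ulcorner\varphi\urcorner$ is the numeral of the Gödel number of $\varphi$. A provability predicate of $T$ is a formula $\mathrm{Pr}_T(x)$ such that for every $n\in\omega$, $\mathsf{PA}\vdash\mathrm{Pr}_T(\overline{n})$ iff $n$ is the Gödel number of a theorem of $T$. Condition $\mathbf{M}$: if $T\vdash\varphi\to\psi$ then $T\vdash\mathrm{Pr}_T(\ulcorner\varphi\urcorner)\to\mathrm{Pr}_T(\ulcorner\psi\urcorner)$. The modal language has propositional variables, $\bot$, $\to$, $\Box$. An arithmetical interpretation based on $\mathrm{Pr}_T$ is a map $f$ from modal formulas to arithmetic sentences (arbitrary on propositional variables) with $f(\bot)$ being $0=1$, $f(A\to B)=f(A)\to f(B)$, $f(\Box A)=\mathrm{Pr}_T(\ulcorner f(A)\urcorner)$. $\mathsf{MN}$ is the modal logic whose axioms are all tautologies and whose rules are modus ponens, necessitation ($A/\Box A$) and RM ($A\to B/\Box A\to\Box B$);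 $\mathsf{MNF}$ is $\mathsf{MN}$ plus the scheme $\Box A\to\Box\Box A$. *)

(* Defs.v *)
From Stdlib Require Import Arith List.
Import ListNotations.

Inductive term : Type :=
| tvar (n : nat)
| tzero
| tsucc (t : term)
| tplus (t u : term)
| tmult (t u : term).

Inductive form : Type :=
| fbot
| feq (t u : term)
| fimp (p q : form)
| fall (p : form).   (* binds de Bruijn variable 0 *)

Fixpoint tsubst (s : nat -> term) (t : term) : term :=
  match t with
  | tvar n => s n
  | tzero => tzero
  | tsucc t => tsucc (tsubst s t)
  | tplus t u => tplus (tsubst s t) (tsubst s u)
  | tmult t u => tmult (tsubst s t) (tsubst s u)
  end.

Definition tshift (t : term) : term := tsubst (fun n => tvar (S n)) t.

Definition up (s : nat -> term) : nat -> term :=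
  fun n => match n with 0 => tvar 0 | S m => tshift (s m) end.

Fixpoint fsubst (s : nat -> term) (p : form) : form :=
  match p with
  | fbot => fbot
  | feq t u => feq (tsubst s t) (tsubst s u)
  | fimp p q => fimp (fsubst s p) (fsubst s q)
  | fall p => fall (fsubst (up s) p)
  end.

Definition fshift (p : form) : form := fsubst (fun n => tvar (S n)) p.

Definition inst0 (t : term) : nat -> term :=
  fun n => match n with 0 => t | S m => tvar m end.

Definition fneg (p : form) : form := fimp p fbot.
Definition fex (p : form) : form := fneg (fall (fneg p)).

Fixpoint tbound (k : nat) (t : term) : Prop :=
  match t with
  | tvar n => n < k
  | tzero => True
  | tsucc t => tbound k t
  | tplus t u | tmult t u => tbound k t /\ tbound k u
  end.

Fixpoint fbound (k : nat) (p : form) : Prop :=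
  match p with
  | fbot => True
  | feq t u => tbound k t /\ tbound k u
  | fimp p q => fbound k p /\ fbound k q
  | fall p => fbound (S k) p
  end.

Definition sentence (p : form) : Prop := fbound 0 p.

Fixpoint num (n : nat) : term :=
  match n with 0 => tzero | S m => tsucc (num m) end.

Inductive LogAx : form -> Prop :=
| ax_K p q : LogAx (fimp p (fimp q p))
| ax_S p q r : LogAx (fimp (fimp p (fimp q r)) (fimp (fimp p q) (fimp p r)))
| ax_DN p : LogAx (fimp (fneg (fneg p)) p)
| ax_inst p t : LogAx (fimp (fall p) (fsubst (inst0 t) p))
| ax_allimp p q : LogAx (fimp (fall (fimp (fshift p) q)) (fimp p (fall q)))
| ax_eq_refl : LogAx (feq (tvar 0) (tvar 0))
| ax_eq_eq : LogAx (fimp (feq (tvar 0) (tvar 1))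
                     (fimp (feq (tvar 0) (tvar 2)) (feq (tvar 1) (tvar 2))))
| ax_eq_succ : LogAx (fimp (feq (tvar 0) (tvar 1)) (feq (tsucc (tvar 0)) (tsucc (tvar 1))))
| ax_eq_plusl : LogAx (fimp (feq (tvar 0) (tvar 1))
                        (feq (tplus (tvar 0) (tvar 2)) (tplus (tvar 1) (tvar 2))))
| ax_eq_plusr : LogAx (fimp (feq (tvar 0) (tvar 1))
                        (feq (tplus (tvar 2) (tvar 0)) (tplus (tvar 2) (tvar 1))))
| ax_eq_multl : LogAx (fimp (feq (tvar 0) (tvar 1))
                        (feq (tmult (tvar 0) (tvar 2)) (tmult (tvar 1) (tvar 2))))
| ax_eq_multr : LogAx (fimp (feq (tvar 0) (tvar 1))
                        (feq (tmult (tvar 2) (tvar 0)) (tmult (tvar 2) (tvar 1)))).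

(* Prv Ax p : p is derivable from the (nonlogical) axioms Ax; open axioms
   are read as their universal closures. *)
Inductive Prv (Ax : form -> Prop) : form -> Prop :=
| prv_ax p : Ax p -> Prv Ax p
| prv_log p : LogAx p -> Prv Ax p
| prv_mp p q : Prv Ax (fimp p q) -> Prv Ax p -> Prv Ax q
| prv_gen p : Prv Ax p -> Prv Ax (fall p).

Definition sucsub : nat -> term :=
  fun n => match n with 0 => tsucc (tvar 0) | S m => tvar (S m) end.

Inductive PAax : form -> Prop :=
| pa_1 : PAax (fneg (feq (tsucc (tvar 0)) tzero))
| pa_2 : PAax (fimp (feq (tsucc (tvar 0)) (tsucc (tvar 1))) (feq (tvar 0) (tvar 1)))
| pa_3 : PAax (feq (tplus (tvar 0) tzero) (tvar 0))
| pa_4 : PAax (feq (tplus (tvar 0) (tsucc (tvar 1))) (tsucc (tplus (tvar 0) (tvar 1))))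
| pa_5 : PAax (feq (tmult (tvar 0) tzero) tzero)
| pa_6 : PAax (feq (tmult (tvar 0) (tsucc (tvar 1))) (tplus (tmult (tvar 0) (tvar 1)) (tvar 0)))
| pa_ind p : PAax (fimp (fsubst (inst0 tzero) p)
                     (fimp (fall (fimp p (fsubst sucsub p))) (fall p))).

Definition PA (p : form) : Prop := Prv PAax p.

Definition cpair (a b : nat) : nat := (a + b) * S (a + b) / 2 + b.

Fixpoint tcode (t : term) : nat :=
  match t with
  | tvar n => cpair 0 n
  | tzero => cpair 1 0
  | tsucc t => cpair 2 (tcode t)
  | tplus t u => cpair 3 (cpair (tcode t) (tcode u))
  | tmult t u => cpair 4 (cpair (tcode t) (tcode u))
  end.

Fixpoint fcode (p : form) : nat :=
  match p with
  | fbot => cpair 0 0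
  | feq t u => cpair 1 (cpair (tcode t) (tcode u))
  | fimp p q => cpair 2 (cpair (fcode p) (fcode q))
  | fall p => cpair 3 (fcode p)
  end.

Definition fle (t u : term) : form := fex (feq (tplus (tvar 0) (tshift t)) (tshift u)).

Inductive Delta0 : form -> Prop :=
| d0_bot : Delta0 fbot
| d0_eq t u : Delta0 (feq t u)
| d0_imp p q : Delta0 p -> Delta0 q -> Delta0 (fimp p q)
| d0_ball t p : Delta0 p -> Delta0 (fall (fimp (fle (tvar 0) (tshift t)) p)).

Inductive Sigma1 : form -> Prop :=
| s1_d0 p : Delta0 p -> Sigma1 p
| s1_ex p : Sigma1 p -> Sigma1 (fex p).

Definition prec_fun (g h : list nat -> nat) (l : list nat) : nat :=
  let rest := tl l in
  nat_rect (fun _ => nat) (g rest) (fun n r => h (n :: r :: rest)) (hd 0 l).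

Inductive PRf : nat -> (list nat -> nat) -> Prop :=
| pr_zero k : PRf k (fun _ => 0)
| pr_succ : PRf 1 (fun l => S (nth 0 l 0))
| pr_proj k i : i < k -> PRf k (fun l => nth i l 0)
| pr_comp k g hs : PRf (length hs) g -> (forall h, In h hs -> PRf k h) ->
    PRf k (fun l => g (map (fun h => h l) hs))
| pr_rec k g h : PRf k g -> PRf (S (S k)) h -> PRf (S k) (prec_fun g h).

Definition PR_axiomatized (T : form -> Prop) : Prop :=
  exists g, PRf 1 g /\
    forall n, g [n] = 0 <-> exists p, T p /\ fcode p = n.

Definition extends_PA (T : form -> Prop) : Prop := forall p, PAax p -> Prv T p.

Definition consistent (T : form -> Prop) : Prop := ~ Prv T fbot.

Definition Pr_at (Pr : form) (n : nat) : form := fsubst (inst0 (num n)) Pr.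

Definition ProvPred (T : form -> Prop) (Pr : form) : Prop :=
  fbound 1 Pr /\
  forall n, PA (Pr_at Pr n) <-> exists p, Prv T p /\ fcode p = n.

Definition CondM (T : form -> Prop) (Pr : form) : Prop :=
  forall p q, Prv T (fimp p q) ->
    Prv T (fimp (Pr_at Pr (fcode p)) (Pr_at Pr (fcode q))).

Inductive mform : Type :=
| mvar (n : nat)
| mbot
| mimp (a b : mform)
| mbox (a : mform).

(* truth value with variables and boxed formulas treated as atoms *)
Fixpoint mtv (v : mform -> bool) (a : mform) : bool :=
  match a with
  | mbot => false
  | mimp a b => implb (mtv v a) (mtv v b)
  | _ => v a
  end.

Definition taut (a : mform) : Prop := forall v, mtv v a = true.

Inductive logic : Type := MN | MNF.

Inductive MPrv (L : logic) : mform -> Prop :=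
| m_taut a : taut a -> MPrv L a
| m_mp a b : MPrv L (mimp a b) -> MPrv L a -> MPrv L b
| m_nec a : MPrv L a -> MPrv L (mbox a)
| m_rm a b : MPrv L (mimp a b) -> MPrv L (mimp (mbox a) (mbox b))
| m_four a : L = MNF -> MPrv L (mimp (mbox a) (mbox (mbox a))).

Fixpoint interp (Pr : form) (f : nat -> form) (a : mform) : form :=
  match a with
  | mvar n => f n
  | mbot => feq tzero (tsucc tzero)
  | mimp a b => fimp (interp Pr f a) (interp Pr f b)
  | mbox a => Pr_at Pr (fcode (interp Pr f a))
  end.

Definition arith_interp (f : nat -> form) : Prop := forall n, sentence (f n).

(* Main.v *)
(* The predicate has the form Pr(x): x belongs to some active stage, a stage d being a finite set of
   formulas.  A stage must be closed under the implications p -> q that T proves (and, for MNF, under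
   p -> Pr(p)), but these edges are released so slowly that every stage can be completed below the number
   at which its last edge appears.  Closure is spelled out in the body of Pr, so PA proves
   Pr(p) -> Pr(q) for an actual edge by instantiating it at a witness beyond a standard bound; below that
   bound PA decides the bounded body of Pr, whose truth is examined in the standard model.  Hence no
   property of coding has to be proved inside PA.

   Active stages contain only theorems of T until some stage d "rings": d refutes, as an assignment of
   truth values to the atoms Pr(n), a theorem of T.  PA knows that nothing is activated afterwards, hence
   decides all these atoms at the first ring and refutes that theorem; so no stage ever rings.  Propositional
   variables are interpreted by Pr(n) for numbers n that code no formula.  If T proved the interpretation of
   an L-unprovable A, then a valuation falsifying A and respecting the L-provable monotonicity laws between
   the boxes of A would give a ringing stage: a false box in the closure of the true ones would be a smaller
   counterexample. *)
From Stdlib Require Import Arith List Lia Classical FunctionalExtensionality.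
Require Import Defs.
Import ListNotations.

(** * Substitution calculus *)

(** The usual provability predicate is too strong here: PA proves for it distribution over
    implication and Löb's principle, neither of which MN or MNF has. So Pr only has to be
    extensionally right, while it stays ready to accept, at a ring, a set of numbers chosen against
    a supposed proof in T. The obstacle is that a stage is a number much larger than its elements:
    among the edges known below its code, many lead out of the range of those elements, so no finite
    stage could respect all of them. Tying the release of an edge to the size of codes of stages,
    and not to the size of the edge, leaves in force only edges that the stage can follow; each
    actual edge is still released at some standard number, which suffices for the instantiation in
    PA. Edges of MNF and rings mention Pr itself. The circle is broken by a parameter: stages are
    defined relative to an arbitrary code [E], and the code of the finished formula is inserted
    last. T is only assumed consistent and may be unsound, so truth in the standard model is used
    for PA and for bounded formulas, never for T. *)

Definition scons {X : Type} (x : X) (s : nat -> X) (n : nat) : X :=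
  match n with 0 => x | S m => s m end.
Notation "x .: s" := (scons x s) (at level 55, right associativity).

Definition tail {X : Type} (s : nat -> X) (n : nat) : X := s (S n).

Definition shift_var (n : nat) : term := tvar (S n).

Lemma scons_tail {X} (s : nat -> X) : s 0 .: tail s = s.
Proof. apply functional_extensionality; intros [|n]; reflexivity. Qed.

Lemma tsubst_comp r s t :
  tsubst s (tsubst r t) = tsubst (fun n => tsubst s (r n)) t.
Proof. induction t; cbn; congruence. Qed.

Lemma tsubst_id t : tsubst tvar t = t.
Proof. induction t; cbn; congruence. Qed.

Lemma tsubst_shift s t : tsubst s (tshift t) = tsubst (tail s) t.
Proof. unfold tshift. now rewrite tsubst_comp. Qed.

Lemma tshift_up s t : tshift (tsubst s t) = tsubst (up s) (tshift t).
Proof. rewrite tsubst_shift. unfold tshift at 1. now rewrite tsubst_comp. Qed.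

Lemma up_comp r s : up (fun n => tsubst s (r n)) = fun n => tsubst (up s) (up r n).
Proof.
  apply functional_extensionality; intros [|n]; cbn [up].
  - reflexivity.
  - now rewrite tshift_up.
Qed.

Lemma fsubst_comp r s p :
  fsubst s (fsubst r p) = fsubst (fun n => tsubst s (r n)) p.
Proof.
  revert r s; induction p; intros r s; cbn.
  - reflexivity.
  - now rewrite !tsubst_comp.
  - now rewrite IHp1, IHp2.
  - now rewrite IHp, up_comp.
Qed.

Lemma up_tvar : up tvar = tvar.
Proof. apply functional_extensionality; intros [|n]; reflexivity. Qed.

Lemma fsubst_id p : fsubst tvar p = p.
Proof. induction p; cbn; rewrite ?up_tvar, ?tsubst_id; congruence. Qed.

Lemma inst0_up t s p :
  fsubst (inst0 t) (fsubst (up s) p) = fsubst (t .: s) p.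
Proof.
  rewrite fsubst_comp. f_equal. apply functional_extensionality; intros [|n]; cbn.
  - reflexivity.
  - rewrite tsubst_shift. apply tsubst_id.
Qed.

Lemma fsubst_inst0 s t p :
  fsubst s (fsubst (inst0 t) p) = fsubst (tsubst s t .: s) p.
Proof.
  rewrite fsubst_comp. f_equal. apply functional_extensionality; intros [|n]; reflexivity.
Qed.

Lemma tsubst_num s n : tsubst s (num n) = num n.
Proof. induction n; cbn; congruence. Qed.

Lemma tshift_num n : tshift (num n) = num n.
Proof. apply tsubst_num. Qed.

Lemma fsubst_fex s p : fsubst s (fex p) = fex (fsubst (up s) p).
Proof. reflexivity. Qed.

Lemma tsubst_ext_bound k t r s :
  tbound k t -> (forall n, n < k -> r n = s n) -> tsubst r t = tsubst s t.
Proof.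
  intros H E; induction t; cbn in *; try reflexivity.
  - now apply E.
  - now rewrite IHt.
  - now rewrite IHt1, IHt2.
  - now rewrite IHt1, IHt2.
Qed.

Lemma fsubst_ext_bound k p r s :
  fbound k p -> (forall n, n < k -> r n = s n) -> fsubst r p = fsubst s p.
Proof.
  revert k r s; induction p; intros k r s H E; cbn in *.
  - reflexivity.
  - destruct H. now rewrite (tsubst_ext_bound k t r s), (tsubst_ext_bound k u r s).
  - destruct H. now rewrite (IHp1 k r s), (IHp2 k r s).
  - f_equal. apply (IHp (S k)); [exact H|]. intros [|n] Hn; cbn; [reflexivity|].
    rewrite E; [reflexivity|lia].
Qed.

Lemma tbound_subst k l t s :
  tbound k t -> (forall n, n < k -> tbound l (s n)) -> tbound l (tsubst s t).
Proof. intros H E; induction t; cbn in *; auto; tauto. Qed.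

Lemma tbound_num k n : tbound k (num n).
Proof. induction n; cbn; auto. Qed.

Lemma tbound_shift k t : tbound k t -> tbound (S k) (tshift t).
Proof. intros H. apply (tbound_subst k); [exact H|]. intros n Hn; cbn; lia. Qed.

Lemma fbound_subst k l p s :
  fbound k p -> (forall n, n < k -> tbound l (s n)) -> fbound l (fsubst s p).
Proof.
  revert k l s; induction p; intros k l s H E; cbn in *; auto.
  - destruct H; split; eapply tbound_subst; eauto.
  - destruct H; split; eauto.
  - apply (IHp (S k)); [exact H|]. intros [|n] Hn; cbn; [lia|].
    apply tbound_shift, E; lia.
Qed.

Lemma tbound_mono k l t : k <= l -> tbound k t -> tbound l t.
Proof. intros; induction t; cbn in *; auto; try lia; tauto. Qed.

Lemma fbound_mono k l p : k <= l -> fbound k p -> fbound l p.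
Proof.
  revert k l; induction p; intros k l H; cbn; auto.
  - intros []; split; eapply tbound_mono; eauto.
  - intros []; split; eauto.
  - apply IHp; lia.
Qed.

Lemma tbound_ex t : exists k, tbound k t.
Proof.
  induction t; cbn.
  - exists (S n); lia.
  - exists 0; auto.
  - exact IHt.
  - destruct IHt1 as [k Hk], IHt2 as [l Hl]. exists (k + l).
    split; eapply tbound_mono; try eassumption; lia.
  - destruct IHt1 as [k Hk], IHt2 as [l Hl]. exists (k + l).
    split; eapply tbound_mono; try eassumption; lia.
Qed.

Lemma fbound_ex p : exists k, fbound k p.
Proof.
  induction p; cbn.
  - exists 0; auto.
  - destruct (tbound_ex t) as [k Hk], (tbound_ex u) as [l Hl]. exists (k + l).
    split; eapply tbound_mono; try eassumption; lia.
  - destruct IHp1 as [k Hk], IHp2 as [l Hl]. exists (k + l).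
    split; eapply fbound_mono; try eassumption; lia.
  - destruct IHp as [k Hk]. exists k. eapply fbound_mono; [|exact Hk]; lia.
Qed.

(** * Truth in the standard model *)

Fixpoint teval (e : nat -> nat) (t : term) : nat :=
  match t with
  | tvar n => e n
  | tzero => 0
  | tsucc t => S (teval e t)
  | tplus t u => teval e t + teval e u
  | tmult t u => teval e t * teval e u
  end.

Fixpoint sat (e : nat -> nat) (p : form) : Prop :=
  match p with
  | fbot => False
  | feq t u => teval e t = teval e u
  | fimp p q => sat e p -> sat e q
  | fall p => forall x, sat (x .: e) p
  end.

Lemma teval_subst e s t : teval e (tsubst s t) = teval (fun n => teval e (s n)) t.
Proof. induction t; cbn; congruence. Qed.

Lemma teval_shift x e t : teval (x .: e) (tshift t) = teval e t.
Proof. unfold tshift. now rewrite teval_subst. Qed.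

Lemma teval_num e n : teval e (num n) = n.
Proof. induction n; cbn; congruence. Qed.

Lemma sat_subst e s p : sat e (fsubst s p) <-> sat (fun n => teval e (s n)) p.
Proof.
  revert e s; induction p; intros e s; cbn.
  - tauto.
  - now rewrite !teval_subst.
  - now rewrite IHp1, IHp2.
  - apply Morphisms_Prop.all_iff_morphism; intros x. rewrite IHp.
    replace (fun n => teval (x .: e) (up s n)) with (x .: (fun n => teval e (s n))); [tauto|].
    apply functional_extensionality; intros [|n]; cbn; [reflexivity|].
    now rewrite teval_shift.
Qed.

Lemma sat_inst0 e t p : sat e (fsubst (inst0 t) p) <-> sat (teval e t .: e) p.
Proof.
  rewrite sat_subst.
  replace (fun n => teval e (inst0 t n)) with (teval e t .: e); [tauto|].
  apply functional_extensionality; intros [|n]; reflexivity.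
Qed.

Lemma sat_fex e p : sat e (fex p) <-> exists x, sat (x .: e) p.
Proof.
  cbn. split.
  - intros H. apply NNPP; intros N. apply H; intros x Hx. apply N; eauto.
  - intros [x Hx] H. exact (H x Hx).
Qed.

Lemma sat_fle e t u : sat e (fle t u) <-> teval e t <= teval e u.
Proof.
  unfold fle. rewrite sat_fex. split.
  - intros [x Hx]; cbn in Hx. rewrite !teval_shift in Hx; lia.
  - intros H. exists (teval e u - teval e t); cbn. rewrite !teval_shift; lia.
Qed.

Lemma LogAx_sound p e : LogAx p -> sat e p.
Proof.
  intros H; revert e; destruct H; intros e; try (cbn; tauto || congruence).
  - cbn [sat]. intros H. apply sat_inst0, H.
  - cbn [sat]. intros H Hp x. apply H. unfold fshift. apply sat_subst. exact Hp.
Qed.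

Lemma PAax_sound p e : PAax p -> sat e p.
Proof.
  destruct 1; cbn; try lia.
  intros H0 HS x. apply sat_inst0 in H0. induction x; [exact H0|].
  specialize (HS x IHx). apply sat_subst in HS.
  replace (S x .: e) with (fun n => teval (x .: e) (sucsub n)); [exact HS|].
  apply functional_extensionality; intros [|n]; reflexivity.
Qed.

(** This is how a PA-proof of Pr(n) yields an actual stage containing n. *)
Lemma PA_sound p : PA p -> forall e, sat e p.
Proof.
  intros H; induction H; intros e.
  - now apply PAax_sound.
  - now apply LogAx_sound.
  - exact (IHPrv1 e (IHPrv2 e)).
  - intros x. apply IHPrv.
Qed.

(** * Natural deduction on top of the Hilbert calculus *)

(** The head of the list is the innermost antecedent, so discharging a hypothesis is a conversion:
    [nd_imp] and [nd_unimp] are identities. *)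
Fixpoint imps (G : list form) (p : form) : form :=
  match G with [] => p | a :: G => imps G (fimp a p) end.

Definition nd (Ax : form -> Prop) (G : list form) (p : form) : Prop := Prv Ax (imps G p).

Section ND.
Context {Ax : form -> Prop}.

Lemma nd_of_Prv G p : Prv Ax p -> nd Ax G p.
Proof.
  unfold nd; revert p; induction G as [|a G IH]; intros p H; cbn; [exact H|].
  apply IH. eapply prv_mp; [apply prv_log, ax_K|exact H].
Qed.

Lemma nd_log G p : LogAx p -> nd Ax G p.
Proof. intros; now apply nd_of_Prv, prv_log. Qed.

Lemma nd_mp G p q : nd Ax G (fimp p q) -> nd Ax G p -> nd Ax G q.
Proof.
  unfold nd; revert p q; induction G as [|a G IH]; cbn; intros p q H1 H2.
  - eapply prv_mp; eassumption.
  - refine (IH _ _ (IH _ _ _ H1) H2). apply nd_of_Prv, prv_log, ax_S.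
Qed.

Lemma nd_mp_Prv G p q : Prv Ax (fimp p q) -> nd Ax G p -> nd Ax G q.
Proof. intros H; apply nd_mp, nd_of_Prv, H. Qed.

Lemma nd_imp G p q : nd Ax (p :: G) q -> nd Ax G (fimp p q).
Proof. exact (fun H => H). Qed.

Lemma nd_unimp G p q : nd Ax G (fimp p q) -> nd Ax (p :: G) q.
Proof. exact (fun H => H). Qed.

Lemma nd_weak1 G p q : nd Ax G q -> nd Ax (p :: G) q.
Proof. intros H. apply nd_unimp. eapply nd_mp; [apply nd_log, ax_K|exact H]. Qed.

Lemma nd_self G p : nd Ax (p :: G) p.
Proof.
  apply nd_unimp, (nd_mp _ (fimp p (fimp p p))).
  - eapply nd_mp; [apply nd_log, ax_S|]. apply nd_log, (ax_K p (fimp p p)).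
  - apply nd_log, ax_K.
Qed.

Lemma nd_hyp G p : In p G -> nd Ax G p.
Proof.
  induction G as [|a G IH]; intros []; [subst; apply nd_self|now apply nd_weak1, IH].
Qed.

Lemma nd_cut G p q : nd Ax G p -> nd Ax (p :: G) q -> nd Ax G q.
Proof. intros H1 H2. exact (nd_mp _ _ _ H2 H1). Qed.

Lemma nd_weak G D p : incl G D -> nd Ax G p -> nd Ax D p.
Proof.
  revert p; induction G as [|a G IH]; intros p I H.
  - apply nd_of_Prv, H.
  - eapply nd_mp; [apply IH; [|exact H]|apply nd_hyp, I; now left].
    intros x Hx; apply I; now right.
Qed.

Lemma nd_exfalso G p : nd Ax G fbot -> nd Ax G p.
Proof.
  intros H. eapply nd_mp; [apply nd_log, ax_DN|]. apply nd_imp, nd_weak1, H.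
Qed.

Lemma nd_contra G p : nd Ax (fneg p :: G) fbot -> nd Ax G p.
Proof. intros H. eapply nd_mp; [apply nd_log, ax_DN|]. apply nd_imp, H. Qed.

Lemma nd_absurd G p q : nd Ax G (fneg p) -> nd Ax G p -> nd Ax G q.
Proof. intros H1 H2. apply nd_exfalso. exact (nd_mp _ _ _ H1 H2). Qed.

Lemma nd_case G p q : nd Ax (p :: G) q -> nd Ax (fneg p :: G) q -> nd Ax G q.
Proof.
  intros H1 H2. apply nd_contra.
  apply (nd_cut _ (fneg p)).
  - apply nd_imp. apply (nd_mp _ q).
    + apply nd_hyp; right; now left.
    + apply (nd_weak (p :: G)); [|exact H1].
      intros x []; [left|right; right]; assumption.
  - apply (nd_mp _ q).
    + apply nd_hyp; right; now left.
    + apply (nd_weak (fneg p :: G)); [|exact H2].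
      intros x []; [left|right; right]; assumption.
Qed.

Lemma nd_gen G p : nd Ax (map fshift G) p -> nd Ax G (fall p).
Proof.
  unfold nd; revert p; induction G as [|a G IH]; cbn; intros p H.
  - now apply prv_gen.
  - apply (nd_mp G (fall (fimp (fshift a) p))).
    + apply nd_log, ax_allimp.
    + apply IH, H.
Qed.

Lemma nd_inst G p t : nd Ax G (fall p) -> nd Ax G (fsubst (inst0 t) p).
Proof. apply nd_mp, nd_log, ax_inst. Qed.

Lemma nd_ex G p t : nd Ax G (fsubst (inst0 t) p) -> nd Ax G (fex p).
Proof.
  intros H. apply nd_imp. apply (nd_mp _ (fsubst (inst0 t) p)).
  - apply (nd_inst _ (fneg p) t), nd_self.
  - apply nd_weak1, H.
Qed.

Lemma nd_ex_elim G p q :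
  nd Ax G (fex p) -> nd Ax (p :: map fshift G) (fshift q) -> nd Ax G q.
Proof.
  intros H1 H2. apply nd_contra.
  apply (nd_mp _ (fall (fneg p))); [apply nd_weak1, H1|].
  apply nd_gen; cbn [map]. apply nd_imp. apply (nd_mp _ (fshift q)).
  - apply nd_hyp; right; now left.
  - eapply nd_weak; [|exact H2]. intros x []; [left|right; right]; assumption.
Qed.

(* Instantiating the variables one at a time, with the terms still to be inserted shifted out of the way. *)
Lemma Prv_subst_aux N s p :
  Prv Ax p -> Prv Ax (fsubst (fun n => if n <? N then s n else tvar (n - N)) p).
Proof.
  revert s p; induction N as [|N IH]; intros s p H.
  - replace (fun n => _) with tvar; [now rewrite fsubst_id|].
    apply functional_extensionality; intros n; cbn. now rewrite Nat.sub_0_r.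
  - assert (H' : Prv Ax (fsubst (inst0 (tsubst (fun n => tvar (n + N)) (s 0))) p)).
    { eapply prv_mp; [apply prv_log, ax_inst|apply prv_gen, H]. }
    apply (IH (tail s)) in H'. rewrite fsubst_inst0 in H'.
    erewrite (f_equal (fun r => fsubst r p)); [exact H'|].
    apply functional_extensionality; intros [|n]; cbn [scons].
    + change (if 0 <? S N then s 0 else tvar (0 - S N)) with (s 0).
      rewrite tsubst_comp, <- (tsubst_id (s 0)) at 1. f_equal.
      apply functional_extensionality; intros n; cbn [tsubst].
      destruct (Nat.ltb_spec (n + N) N); [lia|]. f_equal; lia.
    + reflexivity.
Qed.

Lemma Prv_subst s p : Prv Ax p -> Prv Ax (fsubst s p).
Proof.
  intros H. destruct (fbound_ex p) as [N HN].
  apply (Prv_subst_aux N s) in H. erewrite fsubst_ext_bound; [exact H|exact HN|].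
  intros n Hn. cbv beta. destruct (Nat.ltb_spec n N); [reflexivity|lia].
Qed.

Lemma imps_subst s G p : fsubst s (imps G p) = imps (map (fsubst s) G) (fsubst s p).
Proof. revert p; induction G; intros p; cbn; [reflexivity|]. now rewrite IHG. Qed.

Lemma nd_subst s G p : nd Ax G p -> nd Ax (map (fsubst s) G) (fsubst s p).
Proof. intros H. unfold nd. rewrite <- imps_subst. now apply Prv_subst. Qed.

Lemma nd_shift G p : nd Ax G p -> nd Ax (map fshift G) (fshift p).
Proof. exact (nd_subst shift_var G p). Qed.

(** * Equality *)

Lemma nd_axiom_inst s G p q : Prv Ax p -> fsubst s p = q -> nd Ax G q.
Proof. intros H <-. now apply nd_of_Prv, Prv_subst. Qed.

Definition sub3 (t u v : term) : nat -> term := t .: u .: v .: tvar.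

Ltac eqax A t u v := apply (nd_axiom_inst (sub3 t u v) _ _ _ (prv_log _ _ A) eq_refl).

Lemma nd_refl G t : nd Ax G (feq t t).
Proof. eqax ax_eq_refl t t t. Qed.

Lemma nd_eucl G t u v : nd Ax G (feq t u) -> nd Ax G (feq t v) -> nd Ax G (feq u v).
Proof. intros H. apply nd_mp. eapply nd_mp; [|exact H]. eqax ax_eq_eq t u v. Qed.

Lemma nd_sym G t u : nd Ax G (feq t u) -> nd Ax G (feq u t).
Proof. intros H. eapply nd_eucl; [exact H|apply nd_refl]. Qed.

Lemma nd_trans G t u v : nd Ax G (feq t u) -> nd Ax G (feq u v) -> nd Ax G (feq t v).
Proof. intros H. apply nd_eucl, nd_sym, H. Qed.

Lemma nd_succ G t u : nd Ax G (feq t u) -> nd Ax G (feq (tsucc t) (tsucc u)).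
Proof. apply nd_mp. eqax ax_eq_succ t u u. Qed.

Lemma nd_plus G t u t' u' :
  nd Ax G (feq t t') -> nd Ax G (feq u u') -> nd Ax G (feq (tplus t u) (tplus t' u')).
Proof.
  intros H1 H2. apply (nd_trans _ _ (tplus t' u)).
  - eapply nd_mp; [|exact H1]. eqax ax_eq_plusl t t' u.
  - eapply nd_mp; [|exact H2]. eqax ax_eq_plusr u u' t'.
Qed.

Lemma nd_mult G t u t' u' :
  nd Ax G (feq t t') -> nd Ax G (feq u u') -> nd Ax G (feq (tmult t u) (tmult t' u')).
Proof.
  intros H1 H2. apply (nd_trans _ _ (tmult t' u)).
  - eapply nd_mp; [|exact H1]. eqax ax_eq_multl t t' u.
  - eapply nd_mp; [|exact H2]. eqax ax_eq_multr u u' t'.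
Qed.

Lemma nd_tsubst_eq G r s t :
  (forall n, nd Ax G (feq (r n) (s n))) -> nd Ax G (feq (tsubst r t) (tsubst s t)).
Proof.
  intros H; induction t; cbn.
  - apply H.
  - apply nd_refl.
  - now apply nd_succ.
  - now apply nd_plus.
  - now apply nd_mult.
Qed.

Lemma nd_fsubst_eq p G r s :
  (forall n, nd Ax G (feq (r n) (s n))) -> nd Ax G (fsubst r p) -> nd Ax G (fsubst s p).
Proof.
  revert G r s; induction p; cbn; intros G r s E H.
  - exact H.
  - eapply nd_trans; [apply nd_tsubst_eq; intros n; apply nd_sym, E|].
    eapply nd_trans; [exact H|]. now apply nd_tsubst_eq.
  - apply nd_imp. apply (IHp2 _ r); [intros n; apply nd_weak1, E|].
    eapply nd_mp; [apply nd_weak1, H|].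
    apply (IHp1 _ s); [|apply nd_self]. intros n; apply nd_weak1, nd_sym, E.
  - apply nd_gen. apply (IHp _ (up r)).
    + intros [|n]; cbn; [apply nd_refl|].
      exact (nd_subst shift_var _ _ (E n)).
    (* The shifted universal formula, instantiated at the eigenvariable [tvar 0], gives back its
       body. *)
    + apply nd_shift in H. cbn [fshift fsubst] in H.
      apply (nd_inst _ _ (tvar 0)) in H.
      change (fun n => tvar (S n)) with shift_var in H.
      now rewrite inst0_up, (scons_tail tvar : tvar 0 .: shift_var = tvar), fsubst_id in H.
Qed.

Lemma nd_leibniz G p t u s :
  nd Ax G (feq t u) -> nd Ax G (fsubst (t .: s) p) -> nd Ax G (fsubst (u .: s) p).
Proof.
  intros E. apply nd_fsubst_eq. intros [|n]; cbn; [exact E|apply nd_refl].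
Qed.

End ND.

Lemma nd_mono (A B : form -> Prop) G p : (forall q, A q -> Prv B q) -> nd A G p -> nd B G p.
Proof.
  unfold nd. generalize (imps G p); clear G p. intros p H.
  induction 1 as [p Hp|p Hp|p q _ H1 _ H2|p _ H1].
  - now apply H.
  - now apply prv_log.
  - eapply prv_mp; eassumption.
  - now apply prv_gen.
Qed.

(** * Arithmetic of numerals in Peano arithmetic *)

Notation ndp := (nd PAax).

Ltac paax A s := apply (nd_axiom_inst s _ _ _ (prv_ax _ _ A) eq_refl).

Lemma pa_succ_neq0 G t : ndp G (fneg (feq (tsucc t) tzero)).
Proof. paax pa_1 (t .: tvar). Qed.

Lemma pa_succ_inj G t u : ndp G (feq (tsucc t) (tsucc u)) -> ndp G (feq t u).
Proof. apply nd_mp. paax pa_2 (t .: u .: tvar). Qed.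

Lemma pa_plus0 G t : ndp G (feq (tplus t tzero) t).
Proof. paax pa_3 (t .: tvar). Qed.

Lemma pa_plusS G t u : ndp G (feq (tplus t (tsucc u)) (tsucc (tplus t u))).
Proof. paax pa_4 (t .: u .: tvar). Qed.

Lemma pa_mult0 G t : ndp G (feq (tmult t tzero) tzero).
Proof. paax pa_5 (t .: tvar). Qed.

Lemma pa_multS G t u : ndp G (feq (tmult t (tsucc u)) (tplus (tmult t u) t)).
Proof. paax pa_6 (t .: u .: tvar). Qed.

Lemma pa_num_plus G m n : ndp G (feq (tplus (num m) (num n)) (num (m + n))).
Proof.
  induction n; cbn.
  - rewrite Nat.add_0_r. apply pa_plus0.
  - rewrite Nat.add_succ_r; cbn. eapply nd_trans; [apply pa_plusS|now apply nd_succ].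
Qed.

Lemma pa_num_mult G m n : ndp G (feq (tmult (num m) (num n)) (num (m * n))).
Proof.
  induction n; cbn.
  - rewrite Nat.mul_0_r. apply pa_mult0.
  - rewrite Nat.mul_succ_r. eapply nd_trans; [apply pa_multS|].
    eapply nd_trans; [|apply pa_num_plus]. apply nd_plus; [exact IHn|apply nd_refl].
Qed.

Lemma pa_num_eval G e t : ndp G (feq (tsubst (fun n => num (e n)) t) (num (teval e t))).
Proof.
  induction t; cbn.
  - apply nd_refl.
  - apply nd_refl.
  - now apply nd_succ.
  - eapply nd_trans; [apply nd_plus; eassumption|apply pa_num_plus].
  - eapply nd_trans; [apply nd_mult; eassumption|apply pa_num_mult].
Qed.

Lemma pa_num_neq G m n : m <> n -> ndp G (fneg (feq (num m) (num n))).
Proof.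
  revert G n; induction m; intros G [|n] H; [lia| | |]; cbn.
  - apply nd_imp. eapply nd_mp; [apply pa_succ_neq0|]. apply nd_sym, nd_self.
  - apply pa_succ_neq0.
  - apply nd_imp. eapply nd_mp; [apply (IHm _ n); lia|]. apply pa_succ_inj, nd_self.
Qed.

(** The disjunction comes from the induction axiom for [r]. In the successor case the predecessor is
    the new variable 0, whence the shifts. *)
Lemma pa_zero_or_succ G t q :
  ndp (feq t tzero :: G) q ->
  ndp (feq (tshift t) (tsucc (tvar 0)) :: map fshift G) (fshift q) ->
  ndp G q.
Proof.
  intros H0 HS.
  set (r := fimp (fneg (feq (tvar 0) tzero)) (fex (feq (tvar 1) (tsucc (tvar 0))))).
  assert (Hr : PA (fall r)).
  { eapply prv_mp; [eapply prv_mp; [apply prv_ax, (pa_ind r)|]|].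
    - change (ndp [] (fsubst (inst0 tzero) r)). apply nd_imp. cbn.
      eapply nd_absurd; [apply nd_self|apply nd_refl].
    - apply prv_gen. change (ndp [] (fimp r (fsubst sucsub r))). cbn. apply nd_imp, nd_imp.
      eapply nd_ex. cbn. apply (nd_refl _ (tsucc (tvar 0))). }
  apply (nd_case _ (feq t tzero)); [exact H0|].
  eapply nd_ex_elim.
  - eapply nd_mp; [|apply nd_self]. apply nd_of_Prv.
    pose proof (prv_mp _ _ _ (prv_log _ _ (ax_inst r t)) Hr) as H. exact H.
  - cbn. eapply nd_weak; [|exact HS]. intros x []; [left|right; right]; assumption.
Qed.

Lemma pa_le_intro G w t u : ndp G (feq (tplus w t) u) -> ndp G (fle t u).
Proof.
  intros H. apply (nd_ex _ _ w). cbn. rewrite !tsubst_shift. unfold tail; cbn.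
  now rewrite !tsubst_id.
Qed.

Lemma pa_le_elim G t u q :
  ndp G (fle t u) ->
  ndp (feq (tplus (tvar 0) (tshift t)) (tshift u) :: map fshift G) (fshift q) ->
  ndp G q.
Proof. apply nd_ex_elim. Qed.

Lemma fshift_eq t u : fshift (feq t u) = feq (tshift t) (tshift u).
Proof. reflexivity. Qed.

Lemma fsubst_fle s t u : fsubst s (fle t u) = fle (tsubst s t) (tsubst s u).
Proof. unfold fle, fex, fneg; cbn. now rewrite <- !tshift_up. Qed.

Lemma fshift_fle t u : fshift (fle t u) = fle (tshift t) (tshift u).
Proof. apply fsubst_fle. Qed.

(** Induction on [v] outside PA: after the case distinction on [u], a successor is peeled off both
    sides of the equation z + u = v behind [fle]. *)
Lemma pa_le_num_cases v : forall G u q,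
  ndp G (fle u (num v)) ->
  (forall j, j <= v -> ndp (feq u (num j) :: G) q) -> ndp G q.
Proof.
  induction v as [|v IH]; intros G u q H Hq.
  - apply (pa_zero_or_succ _ u); [apply (Hq 0); lia|].
    apply nd_exfalso. eapply (pa_le_elim _ (tshift u) tzero).
    { apply nd_weak1. apply nd_shift in H. rewrite fshift_fle in H. exact H. }
    change (fshift fbot) with fbot. cbn [map].
    eapply nd_mp; [apply (pa_succ_neq0 _ (tplus (tvar 0) (tvar 1)))|].
    eapply nd_trans; [|apply nd_self]. apply nd_sym.
    eapply nd_trans; [|apply pa_plusS]. apply nd_plus; [apply nd_refl|].
    apply nd_weak1. apply nd_hyp. left. reflexivity.
  - apply (pa_zero_or_succ _ u); [apply (Hq 0); lia|].
    apply (IH _ (tvar 0)).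
    + eapply (pa_le_elim _ (tshift u) (num (S v))).
      { apply nd_weak1. apply nd_shift in H. now rewrite fshift_fle, tshift_num in H. }
      cbn [map]. rewrite fshift_fle, tshift_num. apply (pa_le_intro _ (tvar 0)).
      apply pa_succ_inj. eapply nd_trans; [apply nd_sym, pa_plusS|].
      change (tsucc (num v)) with (num (S v)).
      eapply nd_trans; [|rewrite <- (tshift_num (S v)); apply nd_self].
      apply nd_plus; [apply nd_refl|]. apply nd_weak1, nd_sym, nd_hyp. left. reflexivity.
    + intros j Hj. specialize (Hq (S j) ltac:(lia)).
      apply nd_shift in Hq. cbn [map] in Hq.
      apply (nd_cut _ (fshift (feq u (num (S j))))); [|eapply nd_weak; [|exact Hq]].
      * rewrite fshift_eq, tshift_num.
        eapply nd_trans; [apply nd_hyp; right; left; reflexivity|].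
        cbn. apply nd_succ, nd_self.
      * intros x []; [left; assumption|]. right; right; right. assumption.
Qed.

Lemma pa_zero_plus_num G n : ndp G (feq (tplus tzero (num n)) (num n)).
Proof. apply (pa_num_plus G 0 n). Qed.

(** Induction on the numeral outside PA takes the place of commutativity of addition inside it. *)
Lemma pa_succ_plus_num G t n : ndp G (feq (tplus (tsucc t) (num n)) (tplus t (num (S n)))).
Proof.
  induction n; cbn.
  - eapply nd_trans; [apply pa_plus0|]. apply nd_sym.
    eapply nd_trans; [apply pa_plusS|]. apply nd_succ, pa_plus0.
  - eapply nd_trans; [apply pa_plusS|]. eapply nd_trans; [apply nd_succ, IHn|].
    apply nd_sym, pa_plusS.
Qed.

(** By induction on [K]: given z + K = u, the case z = 0 makes [u] the next numeral, and a successor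
    z yields K + 1 <= u. *)
Lemma pa_num_split K : forall G u q,
  (forall j, j < K -> ndp (feq u (num j) :: G) q) ->
  ndp (fle (num K) u :: G) q -> ndp G q.
Proof.
  induction K as [|K IH]; intros G u q Hj H.
  - eapply nd_cut; [|exact H]. apply (pa_le_intro _ u), pa_plus0.
  - apply (IH _ u); [intros j Hj'; apply Hj; lia|].
    eapply pa_le_elim; [apply nd_self|]. cbn [map].
    apply (pa_zero_or_succ _ (tvar 0)).
    + specialize (Hj K ltac:(lia)). apply nd_shift in Hj.
      apply (nd_cut _ (fshift (feq u (num K)))); [|eapply nd_weak; [|exact Hj]].
      * rewrite fshift_eq, tshift_num.
        apply nd_sym. eapply nd_trans; [|apply nd_hyp; right; left; reflexivity].
        eapply nd_trans; [apply nd_sym, pa_zero_plus_num|].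
        apply nd_plus; [apply nd_sym, nd_self|apply nd_refl].
      * cbn. intros x []; [left; assumption|]. right; right; right; right. assumption.
    + cbn [map]. apply nd_shift, nd_shift in H. cbn [map] in H.
      rewrite !fshift_fle, !tshift_num in H.
      apply (nd_cut _ (fle (num (S K)) (tshift (tshift u)))); [|eapply nd_weak; [|exact H]].
      * apply (pa_le_intro _ (tvar 0)).
        eapply nd_trans; [apply nd_sym, pa_succ_plus_num|].
        eapply nd_trans; [|apply nd_hyp; right; left; rewrite fshift_eq; reflexivity].
        rewrite tshift_num. change (tshift (tplus (tvar 0) (num K))) with (tplus (tvar 1) (tshift (num K))).
        rewrite tshift_num.
        apply nd_plus; [apply nd_sym, nd_self|apply nd_refl].
      * intros x []; [left; assumption|]. right; right; right; right. assumption.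
Qed.

Lemma pa_plus_num_assoc G t i j :
  ndp G (feq (tplus (tplus t (num i)) (num j)) (tplus t (num (i + j)))).
Proof.
  induction j; cbn.
  - rewrite Nat.add_0_r. apply pa_plus0.
  - rewrite Nat.add_succ_r; cbn.
    eapply nd_trans; [apply pa_plusS|]. apply nd_sym.
    eapply nd_trans; [apply pa_plusS|]. apply nd_succ, nd_sym, IHj.
Qed.

Lemma pa_le_num_trans G j K u : j <= K -> ndp G (fle (num K) u) -> ndp G (fle (num j) u).
Proof.
  intros Hle H. eapply pa_le_elim; [exact H|].
  rewrite fshift_fle, !tshift_num.
  apply (pa_le_intro _ (tplus (tvar 0) (num (K - j)))).
  eapply nd_trans; [|apply nd_self].
  replace (num K) with (num (K - j + j)) by (f_equal; lia).
  apply pa_plus_num_assoc.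
Qed.

(** * Peano arithmetic decides bounded formulas *)

Definition numv (e : nat -> nat) (n : nat) : term := num (e n).

Lemma numv_scons x e : numv (x .: e) = num x .: numv e.
Proof. apply functional_extensionality; intros [|n]; reflexivity. Qed.

(** A bounded quantifier is replaced by its finitely many numerical instances through
    [pa_le_num_cases]; which half applies is settled by classical truth in the standard model. *)
Lemma Delta0_decide p : Delta0 p -> forall e,
  (sat e p -> PA (fsubst (numv e) p)) /\ (~ sat e p -> PA (fneg (fsubst (numv e) p))).
Proof.
  induction 1 as [|t u|p q _ IHp _ IHq|t p _ IH]; intros e.
  - split; [intros []|intros _]. apply (nd_self (Ax := PAax) [] fbot).
  - cbn [sat fsubst]. split; intros H.
    + apply (nd_trans (Ax := PAax) [] _ (num (teval e t))); [apply pa_num_eval|].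
      rewrite H. apply nd_sym, pa_num_eval.
    + apply (nd_imp (Ax := PAax) []). eapply nd_mp; [apply (pa_num_neq _ _ _ H)|].
      eapply nd_trans; [apply nd_sym, pa_num_eval|].
      eapply nd_trans; [apply nd_self|apply pa_num_eval].
  - destruct (IHp e) as [Tp Fp], (IHq e) as [Tq Fq]. cbn [sat fsubst]. split; intros H.
    + apply (nd_imp (Ax := PAax) []). destruct (classic (sat e p)) as [Hp|Hp].
      * apply nd_of_Prv, Tq, H, Hp.
      * eapply nd_absurd; [apply nd_of_Prv, Fp, Hp|apply nd_self].
    + apply imply_to_and in H as [Hp Hq]. apply (nd_imp (Ax := PAax) []).
      eapply nd_mp; [apply nd_of_Prv, Fq, Hq|].
      eapply nd_mp; [apply nd_self|apply nd_of_Prv, Tp, Hp].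
  - cbn [fsubst]. rewrite fsubst_fle, <- tshift_up. cbn [tsubst up].
    set (t' := tsubst (numv e) t).
    assert (Et : forall G, ndp G (feq t' (num (teval e t)))) by (intros; apply pa_num_eval).
    split; intros H.
    + apply (nd_gen (Ax := PAax) []). cbn [map]. apply nd_imp.
      apply (pa_le_num_cases (teval e t) _ (tvar 0)).
      * pose proof (nd_leibniz (Ax := PAax) [fle (tvar 0) (tshift t')] (fle (tvar 1) (tvar 0))
          (tshift t') (num (teval e t)) (tvar 0 .: tvar)) as L.
        rewrite !fsubst_fle in L. apply L; [|apply nd_self]. apply nd_weak1.
        specialize (Et []). apply nd_shift in Et. now rewrite fshift_eq, tshift_num in Et.
      * intros j Hj. apply (nd_fsubst_eq p _ (num j .: numv e)).
        -- intros [|n]; cbn [scons up].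
           ++ apply nd_sym, nd_self.
           ++ unfold numv. rewrite tshift_num. apply nd_refl.
        -- rewrite <- numv_scons. apply nd_of_Prv, IH, H.
           apply sat_fle. rewrite teval_shift. exact Hj.
    + apply not_all_ex_not in H as [x H]. apply imply_to_and in H as [Hx Hp].
      apply sat_fle in Hx. rewrite teval_shift in Hx. cbn in Hx.
      apply (nd_imp (Ax := PAax) []).
      pose proof (nd_inst (Ax := PAax) _ _ (num x) (nd_self [] (fall (fimp (fle (tvar 0) (tshift t'))
        (fsubst (up (numv e)) p))))) as I.
      cbn [fsubst] in I. rewrite fsubst_fle, inst0_up, tsubst_shift, <- numv_scons in I.
      change (tail (inst0 (num x))) with tvar in I. rewrite tsubst_id in I. cbn [tsubst inst0] in I.
      eapply nd_mp; [apply nd_of_Prv, IH, Hp|]. eapply nd_mp; [exact I|].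
      apply (pa_le_intro _ (num (teval e t - x))).
      eapply nd_trans; [apply pa_num_plus|]. rewrite Nat.sub_add by exact Hx. apply nd_sym, Et.
Qed.

Lemma Delta0_subst p : Delta0 p -> forall s, Delta0 (fsubst s p).
Proof.
  induction 1; intros s; cbn [fsubst]; try (constructor; auto; fail).
  rewrite fsubst_fle, <- tshift_up. constructor; auto.
Qed.

(** * Bounded and r.e. relations on the standard model *)

(** Relations are predicates of the environment, with variable 0 for the innermost quantifier. The
    closure lemmas let [auto] assemble a bounded formula from the shape of a relation, so that most
    formulas need not be written out. *)
Definition D0 (R : (nat -> nat) -> Prop) : Prop :=
  exists p, Delta0 p /\ forall e, sat e p <-> R e.

Definition Tm (a : (nat -> nat) -> nat) : Prop := exists t, forall e, teval e t = a e.

Lemma Tm_var k : Tm (fun e => e k).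
Proof. now exists (tvar k). Qed.

Lemma Tm_const k : Tm (fun _ => k).
Proof. exists (num k). intros e; apply teval_num. Qed.

Lemma Tm_S a : Tm a -> Tm (fun e => S (a e)).
Proof. intros [t H]. exists (tsucc t). intros e; cbn. now rewrite H. Qed.

Lemma Tm_add a b : Tm a -> Tm b -> Tm (fun e => a e + b e).
Proof. intros [t H] [u K]. exists (tplus t u). intros e; cbn. now rewrite H, K. Qed.

Lemma Tm_mul a b : Tm a -> Tm b -> Tm (fun e => a e * b e).
Proof. intros [t H] [u K]. exists (tmult t u). intros e; cbn. now rewrite H, K. Qed.

Lemma D0_ext R R' : (forall e, R e <-> R' e) -> D0 R -> D0 R'.
Proof. intros E [p [H1 H2]]. exists p. split; [exact H1|]. intros e. now rewrite H2. Qed.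

Lemma D0_eq a b : Tm a -> Tm b -> D0 (fun e => a e = b e).
Proof.
  intros [t H] [u K]. exists (feq t u). split; [constructor|].
  intros e; cbn. now rewrite H, K.
Qed.

Lemma D0_imp R R' : D0 R -> D0 R' -> D0 (fun e => R e -> R' e).
Proof.
  intros [p [P1 P2]] [q [Q1 Q2]]. exists (fimp p q). split; [now constructor|].
  intros e; cbn. now rewrite P2, Q2.
Qed.

Lemma D0_False : D0 (fun _ => False).
Proof. exists fbot. split; [constructor|tauto]. Qed.

Lemma D0_not R : D0 R -> D0 (fun e => ~ R e).
Proof. intros H. exact (D0_imp _ _ H D0_False). Qed.

Lemma D0_and R R' : D0 R -> D0 R' -> D0 (fun e => R e /\ R' e).
Proof.
  intros H H'. apply (D0_ext (fun e => ~ (R e -> ~ R' e))).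
  - intros e; tauto.
  - auto using D0_not, D0_imp.
Qed.

Lemma D0_or R R' : D0 R -> D0 R' -> D0 (fun e => R e \/ R' e).
Proof.
  intros H H'. apply (D0_ext (fun e => ~ R e -> R' e)).
  - intros e; tauto.
  - auto using D0_not, D0_imp.
Qed.

Lemma D0_ball a (R : nat -> (nat -> nat) -> Prop) :
  Tm a -> D0 (fun e => R (e 0) (fun n => e (S n))) -> D0 (fun e => forall x, x <= a e -> R x e).
Proof.
  intros [t Ht] [p [P1 P2]]. exists (fall (fimp (fle (tvar 0) (tshift t)) p)).
  split; [now constructor|]. intros e.
  apply Morphisms_Prop.all_iff_morphism; intros x.
  change ((sat (x .: e) (fle (tvar 0) (tshift t)) -> sat (x .: e) p) <-> (x <= a e -> R x e)).
  rewrite sat_fle, teval_shift, Ht. cbn [teval scons]. now rewrite P2.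
Qed.

Lemma D0_bex a (R : nat -> (nat -> nat) -> Prop) :
  Tm a -> D0 (fun e => R (e 0) (fun n => e (S n))) ->
  D0 (fun e => exists x, x <= a e /\ R x e).
Proof.
  intros Ha H. apply (D0_ext (fun e => ~ (forall x, x <= a e -> ~ R x e))).
  - intros e. split.
    + intros N. apply NNPP. intros M. apply N. intros x Hx Hr. apply M; eauto.
    + intros [x [Hx Hr]] N. exact (N x Hx Hr).
  - apply D0_not, (D0_ball a (fun x e => ~ R x e)); [exact Ha|]. now apply D0_not.
Qed.

Lemma D0_le a b : Tm a -> Tm b -> D0 (fun e => a e <= b e).
Proof.
  intros Ha [u Hb]. apply (D0_ext (fun e => exists x, x <= b e /\ x = a e)).
  - intros e; split; [intros [x [H ->]]; exact H|eauto].
  - apply (D0_bex b (fun x e => x = a e)); [now exists u|].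
    apply D0_eq; [apply Tm_var|]. destruct Ha as [t Ht]. exists (tshift t).
    intros e. unfold tshift. rewrite teval_subst. apply Ht.
Qed.

Lemma D0_lt a b : Tm a -> Tm b -> D0 (fun e => a e < b e).
Proof. intros Ha Hb. apply D0_le; [now apply Tm_S|exact Hb]. Qed.

Lemma D0_subst R (s : nat -> term) : D0 R -> D0 (fun e => R (fun n => teval e (s n))).
Proof.
  intros [p [P1 P2]]. exists (fsubst s p). split; [now apply Delta0_subst|].
  intros e. now rewrite sat_subst, P2.
Qed.

Lemma D0_ren R (r : nat -> nat) : D0 R -> D0 (fun e => R (fun n => e (r n))).
Proof. exact (D0_subst R (fun n => tvar (r n))). Qed.

Lemma D0_app2 (P : nat -> nat -> Prop) a b :
  D0 (fun e => P (e 0) (e 1)) -> Tm a -> Tm b -> D0 (fun e => P (a e) (b e)).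
Proof.
  intros H [t Ha] [u Hb]. apply (D0_subst _ (t .: u .: tvar)) in H. revert H. apply D0_ext.
  intros e; cbn. now rewrite Ha, Hb.
Qed.

Lemma D0_app3 (P : nat -> nat -> nat -> Prop) a b c :
  D0 (fun e => P (e 0) (e 1) (e 2)) -> Tm a -> Tm b -> Tm c ->
  D0 (fun e => P (a e) (b e) (c e)).
Proof.
  intros H [t Ha] [u Hb] [v Hc]. apply (D0_subst _ (t .: u .: v .: tvar)) in H.
  revert H. apply D0_ext. intros e; cbn. now rewrite Ha, Hb, Hc.
Qed.

Lemma D0_app4 (P : nat -> nat -> nat -> nat -> Prop) a b c d :
  D0 (fun e => P (e 0) (e 1) (e 2) (e 3)) -> Tm a -> Tm b -> Tm c -> Tm d ->
  D0 (fun e => P (a e) (b e) (c e) (d e)).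
Proof.
  intros H [t Ha] [u Hb] [v Hc] [w Hd].
  apply (D0_subst _ (t .: u .: v .: w .: tvar)) in H.
  revert H. apply D0_ext. intros e; cbn. now rewrite Ha, Hb, Hc, Hd.
Qed.

Create HintDb d0.
#[global] Hint Resolve Tm_var Tm_const Tm_S Tm_add Tm_mul D0_eq D0_imp D0_False D0_not D0_and
  D0_or D0_le D0_lt : d0.
#[global] Hint Extern 1 (D0 (fun _ => forall _, _)) => (eapply D0_ball; cbv beta) : d0.
#[global] Hint Extern 1 (D0 (fun _ => exists _, _)) => (eapply D0_bex; cbv beta) : d0.

(** * Cantor's pairing function as a bounded relation *)

(** Clearing the division turns pairing into a polynomial equation, fit both for [nia] and for an
    atomic formula. *)
Lemma cpair_double a b : 2 * cpair a b = (a + b) * S (a + b) + 2 * b.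
Proof.
  unfold cpair.
  assert (H : ((a + b) * S (a + b)) mod 2 = 0).
  { generalize (a + b); intros n. induction n as [|n IH]; [reflexivity|].
    replace (S n * S (S n)) with (n * S n + (S n) * 2) by ring.
    now rewrite Nat.Div0.mod_add. }
  pose proof (Nat.div_mod_eq ((a + b) * S (a + b)) 2). lia.
Qed.

Lemma cpair_inj a b a' b' : cpair a b = cpair a' b' -> a = a' /\ b = b'.
Proof.
  intros H. pose proof (cpair_double a b) as H1. pose proof (cpair_double a' b') as H2.
  rewrite H in H1. clear H. assert (E : a + b = a' + b'); [|nia].
  destruct (lt_eq_lt_dec (a + b) (a' + b')) as [[L|E]|L]; [exfalso|exact E|exfalso]; nia.
Qed.

Lemma cpair_le_l a b : a <= cpair a b.
Proof. pose proof (cpair_double a b). nia. Qed.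

Lemma cpair_le_r a b : b <= cpair a b.
Proof. pose proof (cpair_double a b). nia. Qed.

Lemma cpair_mono a b a' b' : a <= a' -> b <= b' -> cpair a b <= cpair a' b'.
Proof. intros. pose proof (cpair_double a b). pose proof (cpair_double a' b'). nia. Qed.

Lemma D0_cpair a b c : Tm a -> Tm b -> Tm c -> D0 (fun e => c e = cpair (a e) (b e)).
Proof.
  intros. apply (D0_ext (fun e => 2 * c e = (a e + b e) * S (a e + b e) + 2 * b e));
    [|auto 10 with d0].
  intros e. rewrite <- cpair_double. lia.
Qed.
#[global] Hint Resolve D0_cpair : d0.

Lemma D0_cpair2 a b c d :
  Tm a -> Tm b -> Tm c -> Tm d -> D0 (fun e => d e = cpair (a e) (cpair (b e) (c e))).
Proof.
  apply (D0_app4 (fun a b c d => d = cpair a (cpair b c))).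
  apply (D0_ext (fun e => exists z, z <= e 3 /\ z = cpair (e 1) (e 2) /\ e 3 = cpair (e 0) z)).
  - intros e; split; [now intros (z & _ & -> & H)|].
    intros ->. eexists. split; [apply cpair_le_r|auto].
  - auto 10 with d0.
Qed.

Lemma D0_cpair3 a b c d f : Tm a -> Tm b -> Tm c -> Tm d -> Tm f ->
  D0 (fun e => f e = cpair (a e) (cpair (b e) (cpair (c e) (d e)))).
Proof.
  intros [t Ha] [u Hb] [v Hc] [w Hd] [y Hf].
  assert (H : D0 (fun e => exists z, z <= e 4 /\ z = cpair (e 2) (e 3) /\ e 4 = cpair (e 0) (cpair (e 1) z)))
    by auto 10 using D0_cpair2 with d0.
  apply (D0_subst _ (t .: u .: v .: w .: y .: tvar)) in H. revert H. apply D0_ext.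
  intros e; cbn. rewrite Ha, Hb, Hc, Hd, Hf. split.
  - now intros (z & _ & -> & H).
  - intros ->. eexists. split; [|split; reflexivity].
    etransitivity; [|apply cpair_le_r]. apply cpair_le_r.
Qed.
#[global] Hint Resolve D0_cpair2 D0_cpair3 : d0.

(** * R.e. relations and functions with r.e. graph *)

Definition S1 (R : (nat -> nat) -> Prop) : Prop :=
  exists R', D0 R' /\ forall e, R e <-> exists w, R' (w .: e).

Definition F1 (a : (nat -> nat) -> nat) : Prop := S1 (fun e => e 0 = a (fun n => e (S n))).

Lemma S1_ext R R' : (forall e, R e <-> R' e) -> S1 R -> S1 R'.
Proof. intros E [Q [H1 H2]]. exists Q. split; [exact H1|]. intros e. now rewrite <- E. Qed.

Lemma S1_D0 R : D0 R -> S1 R.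
Proof.
  intros H. exists (fun e => R (fun n => e (S n))). split; [now apply D0_ren|].
  intros e; split; [intros Hr; exists 0; exact Hr|intros [w Hr]; exact Hr].
Qed.

Lemma S1_ren R (r : nat -> nat) : S1 R -> S1 (fun e => R (fun n => e (r n))).
Proof.
  intros [Q [H1 H2]]. set (s := fun n => match n with 0 => 0 | S m => S (r m) end).
  exists (fun e => Q (fun n => e (s n))). split; [now apply D0_ren|].
  intros e. rewrite H2. apply Morphisms_Prop.ex_iff_morphism. intros w.
  replace (fun n => (w .: e) (s n)) with (w .: fun n => e (r n)); [tauto|].
  apply functional_extensionality; intros [|n]; reflexivity.
Qed.

(** Two unbounded quantifiers become one: a single number bounds both witnesses, which are then
    searched below it. Their sum is such a bound. *)
Lemma S1_ex (R : nat -> (nat -> nat) -> Prop) :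
  S1 (fun e => R (e 0) (fun n => e (S n))) -> S1 (fun e => exists x, R x e).
Proof.
  intros [Q [H1 H2]].
  exists (fun e => exists w, w <= e 0 /\ exists x, x <= e 0 /\ Q (w .: x .: fun n => e (S n))).
  split.
  - apply D0_bex; [auto with d0|]. cbv beta. apply D0_bex; [auto with d0|]. cbv beta.
    apply (D0_ren _ (fun n => match n with 0 => 1 | 1 => 0 | S (S m) => S (S (S m)) end)) in H1.
    revert H1. apply D0_ext. intros e. match goal with |- Q ?f <-> Q ?g => replace f with g; [tauto|] end.
    apply functional_extensionality; intros [|[|n]]; reflexivity.
  - intros e. split.
    + intros [x Hx]. apply (H2 (x .: e)) in Hx as [w Hw].
      exists (w + x), w. split; [cbn; lia|]. exists x. split; [cbn; lia|exact Hw].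
    + intros [W [w [Hle [x [Hle' Hw]]]]]. exists x. apply (H2 (x .: e)). exists w. exact Hw.
Qed.

Lemma S1_and R R' : S1 R -> S1 R' -> S1 (fun e => R e /\ R' e).
Proof.
  intros [Q [H1 H2]] [Q' [H1' H2']].
  apply (S1_ext (fun e => exists w, Q (w .: e) /\ exists w', Q' (w' .: e))).
  - intros e. rewrite H2, H2'. firstorder.
  - apply (S1_ex (fun w e => Q (w .: e) /\ exists w', Q' (w' .: e))).
    apply (S1_ext (fun e => exists w', Q e /\ Q' (w' .: fun n => e (S n)))).
    + intros e. rewrite (scons_tail e : e 0 .: (fun n => e (S n)) = e). firstorder.
    + apply (S1_ex (fun w' e => Q e /\ Q' (w' .: fun n => e (S n)))), S1_D0, D0_and.
      * now apply (D0_ren _ S) in H1.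
      * apply (D0_ren _ (fun n => match n with 0 => 0 | S m => S (S m) end)) in H1'.
        revert H1'. apply D0_ext. intros e.
        match goal with |- Q' ?f <-> Q' ?g => replace f with g; [tauto|] end.
        apply functional_extensionality; intros [|n]; reflexivity.
Qed.

Lemma S1_or R R' : S1 R -> S1 R' -> S1 (fun e => R e \/ R' e).
Proof.
  intros [Q [H1 H2]] [Q' [H1' H2']].
  exists (fun e => Q e \/ Q' e). split; [now apply D0_or|].
  intros e. rewrite H2, H2'. firstorder.
Qed.

Lemma bounded_collection (P : nat -> nat -> Prop) k :
  (forall x, x <= k -> exists w, P x w) -> exists W, forall x, x <= k -> exists w, w <= W /\ P x w.
Proof.
  induction k as [|k IH]; intros H.
  - destruct (H 0 (le_n 0)) as [w Hw]. exists w. intros x Hx.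
    replace x with 0 by lia. eauto.
  - destruct IH as [W HW]; [intros x Hx; apply H; lia|].
    destruct (H (S k) (le_n _)) as [w Hw]. exists (W + w). intros x Hx.
    destruct (Nat.eq_dec x (S k)) as [->|N].
    + exists w. split; [lia|exact Hw].
    + destruct (HW x) as [w' [? ?]]; [lia|]. exists w'. split; [lia|assumption].
Qed.

(** Collection: finitely many witnesses have a common bound, so the existential quantifier moves in
    front of the bounded one. *)
Lemma S1_ball_Tm a (R : nat -> (nat -> nat) -> Prop) :
  Tm a -> S1 (fun e => R (e 0) (fun n => e (S n))) -> S1 (fun e => forall x, x <= a e -> R x e).
Proof.
  intros [t Ht] [Q [H1 H2]].
  exists (fun e => forall x, x <= a (fun n => e (S n)) ->
            exists w, w <= e 0 /\ Q (w .: x .: fun n => e (S n))).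
  split.
  - apply D0_ball.
    { exists (tsubst (fun n => tvar (S n)) t). intros e. rewrite teval_subst. apply Ht. }
    cbv beta. apply D0_bex; [auto with d0|]. cbv beta.
    apply (D0_ren _ (fun n => match n with 0 => 0 | 1 => 1 | S (S m) => S (S (S m)) end)) in H1.
    revert H1. apply D0_ext. intros e. match goal with |- Q ?f <-> Q ?g => replace f with g; [tauto|] end.
    apply functional_extensionality; intros [|[|n]]; reflexivity.
  - intros e. split.
    + intros H. apply (bounded_collection (fun x w => Q (w .: x .: e)) (a e)). intros x Hx. apply (H2 (x .: e)), H, Hx.
    + intros [W HW] x Hx. apply (H2 (x .: e)). destruct (HW x Hx) as [w [Hle Hw]]. eauto.
Qed.

Lemma F1_Tm a : Tm a -> F1 a.
Proof.
  intros [t Ht]. apply S1_D0, D0_eq; [auto with d0|].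
  exists (tsubst (fun n => tvar (S n)) t). intros e. rewrite teval_subst. apply Ht.
Qed.

Lemma F1_var k : F1 (fun e => e k).
Proof. auto using F1_Tm with d0. Qed.

Lemma F1_const k : F1 (fun _ => k).
Proof. auto using F1_Tm with d0. Qed.

Lemma F1_ren r a : F1 a -> F1 (fun e => a (fun n => e (r n))).
Proof.
  exact (S1_ren (fun e => e 0 = a (fun n => e (S n)))
    (fun n => match n with 0 => 0 | S m => S (r m) end)).
Qed.

Lemma F1_shift a : F1 a -> F1 (fun e => a (fun n => e (S n))).
Proof. apply F1_ren. Qed.

Lemma S1_subst1 (R : nat -> (nat -> nat) -> Prop) a :
  S1 (fun e => R (e 0) (fun n => e (S n))) -> F1 a -> S1 (fun e => R (a e) e).
Proof.
  intros H Ha. apply (S1_ext (fun e => exists x, x = a e /\ R x e)).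
  - intros e; split; [now intros [x [-> Hx]]|eauto].
  - apply (S1_ex (fun x e => x = a e /\ R x e)). now apply S1_and.
Qed.

Lemma S1_app1 (P : nat -> Prop) a : S1 (fun e => P (e 0)) -> F1 a -> S1 (fun e => P (a e)).
Proof. intros H. exact (S1_subst1 (fun x _ => P x) a H). Qed.

Lemma S1_app2 (P : nat -> nat -> Prop) a b :
  S1 (fun e => P (e 0) (e 1)) -> F1 a -> F1 b -> S1 (fun e => P (a e) (b e)).
Proof.
  intros H Ha Hb. apply (S1_subst1 (fun x e => P x (b e)) a); [|exact Ha].
  apply (S1_subst1 (fun y e => P (e 0) y) (fun e => b (fun n => e (S n)))); [|now apply F1_shift].
  exact (S1_ren _ (fun n => match n with 0 => 1 | _ => 0 end) H).
Qed.

Lemma S1_app3 (P : nat -> nat -> nat -> Prop) a b c :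
  S1 (fun e => P (e 0) (e 1) (e 2)) -> F1 a -> F1 b -> F1 c ->
  S1 (fun e => P (a e) (b e) (c e)).
Proof.
  intros H Ha Hb Hc. apply (S1_subst1 (fun x e => P x (b e) (c e)) a); [|exact Ha].
  apply (S1_subst1 (fun y e => P (e 0) y (c (fun n => e (S n)))) (fun e => b (fun n => e (S n))));
    [|now apply F1_shift].
  apply (S1_subst1 (fun z e => P (e 1) (e 0) z) (fun e => c (fun n => e (S (S n)))));
    [|now apply (F1_ren (fun n => S (S n)))].
  exact (S1_ren _ (fun n => match n with 0 => 2 | 1 => 1 | _ => 0 end) H).
Qed.

Lemma F1_app1 (f : nat -> nat) a : F1 (fun e => f (e 0)) -> F1 a -> F1 (fun e => f (a e)).
Proof.
  intros H Ha. apply (S1_app2 (fun x y => x = f y)); [exact H|apply F1_var|now apply F1_shift].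
Qed.

Lemma F1_app2 (f : nat -> nat -> nat) a b :
  F1 (fun e => f (e 0) (e 1)) -> F1 a -> F1 b -> F1 (fun e => f (a e) (b e)).
Proof.
  intros H Ha Hb. apply (S1_app3 (fun x y z => x = f y z));
    [exact H|apply F1_var|now apply F1_shift|now apply (F1_shift b)].
Qed.

Lemma F1_S a : F1 a -> F1 (fun e => S (a e)).
Proof. apply (F1_app1 S). auto using F1_Tm with d0. Qed.

Lemma F1_cpair a b : F1 a -> F1 b -> F1 (fun e => cpair (a e) (b e)).
Proof. apply (F1_app2 cpair). apply S1_D0. auto with d0. Qed.

Lemma S1_eq a b : F1 a -> F1 b -> S1 (fun e => a e = b e).
Proof. apply (S1_app2 eq). apply S1_D0. auto with d0. Qed.

Lemma S1_le a b : F1 a -> F1 b -> S1 (fun e => a e <= b e).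
Proof. apply (S1_app2 le). apply S1_D0. auto with d0. Qed.

Lemma S1_lt a b : F1 a -> F1 b -> S1 (fun e => a e < b e).
Proof. apply (S1_app2 lt). apply S1_D0. auto with d0. Qed.

Lemma S1_Prop (P : Prop) : S1 (fun _ => P).
Proof.
  apply S1_D0. destruct (classic P).
  - apply (D0_ext (fun _ => False -> False)); [tauto|auto with d0].
  - apply (D0_ext (fun _ => False)); [tauto|auto with d0].
Qed.

Lemma S1_ball a (R : nat -> (nat -> nat) -> Prop) :
  F1 a -> S1 (fun e => R (e 0) (fun n => e (S n))) -> S1 (fun e => forall x, x <= a e -> R x e).
Proof.
  intros Ha H. apply (S1_subst1 (fun b e => forall x, x <= b -> R x e) a); [|exact Ha].
  apply (S1_ball_Tm (fun e => e 0) (fun x e => R x (fun n => e (S n)))); [apply Tm_var|].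
  exact (S1_ren _ (fun n => match n with 0 => 0 | S m => S (S m) end) H).
Qed.

Create HintDb s1.
#[global] Hint Resolve F1_var F1_const F1_S F1_cpair S1_eq S1_le S1_lt S1_and S1_or : s1.
#[global] Hint Extern 1 (S1 (fun _ => exists _, _)) => (eapply S1_ex; cbv beta) : s1.
#[global] Hint Extern 2 (S1 (fun _ => forall _, _)) => (eapply S1_ball; cbv beta) : s1.

(** * Finite sets as numbers *)

(* [cpair cap (cpair b a)] codes the set of those [x <= cap] for which Goedel's modulus [1 + (x+1)b] divides [a]. *)
Definition inset (k x : nat) : Prop :=
  exists cap, cap <= k /\ exists b, b <= k /\ exists a, a <= k /\
    k = cpair cap (cpair b a) /\ x <= cap /\ exists q, q <= a /\ a = q * S (S x * b).

Lemma D0_inset k x : Tm k -> Tm x -> D0 (fun e => inset (k e) (x e)).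
Proof. apply D0_app2. unfold inset. auto 50 with d0. Qed.
#[global] Hint Resolve D0_inset : d0.

Lemma inset_cpair cap b a x :
  inset (cpair cap (cpair b a)) x <-> x <= cap /\ Nat.divide (S (S x * b)) a.
Proof.
  split.
  - intros (cap' & _ & b' & _ & a' & _ & E & Hx & q & _ & Eq).
    apply cpair_inj in E as [<- E]. apply cpair_inj in E as [<- <-].
    split; [exact Hx|now exists q].
  - intros [Hx [q Eq]]. exists cap. split; [apply cpair_le_l|].
    pose proof (cpair_le_r cap (cpair b a)). pose proof (cpair_le_l b a).
    pose proof (cpair_le_r b a).
    exists b. split; [lia|]. exists a. split; [lia|]. split; [reflexivity|]. split; [exact Hx|].
    exists q. split; [nia|exact Eq].
Qed.

Lemma inset_le k x : inset k x -> x <= k.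
Proof. intros (cap & H & b & _ & a & _ & _ & Hx & _). lia. Qed.

(** Here [cpair cap (cpair b a)] codes the whole interval up to [cap]. Divisibility of [b] makes the
    moduli coprime, and every subset is then coded with the same [cap] and [b] and a divisor of [a],
    so the full code bounds the codes of all its subsets. *)
Definition full (cap b a : nat) : Prop :=
  0 < b /\ 0 < a /\
  forall x, x <= cap -> (exists q, q <= b /\ b = q * S x) /\ (exists q, q <= a /\ a = q * S (S x * b)).

Lemma D0_full c b a : Tm c -> Tm b -> Tm a -> D0 (fun e => full (c e) (b e) (a e)).
Proof. apply D0_app3. unfold full. auto 50 with d0. Qed.
#[global] Hint Resolve D0_full : d0.

Lemma full_ex cap : exists b a, full cap b a.
Proof.
  assert (Hb : forall n, exists b, 0 < b /\ forall x, x < n -> Nat.divide (S x) b).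
  { induction n as [|n [b [Hb H]]]; [exists 1; split; lia|].
    exists (b * S n). split; [nia|]. intros x Hx.
    destruct (Nat.eq_dec x n) as [->|]; [now exists b|].
    apply Nat.divide_mul_l, H; lia. }
  destruct (Hb (S cap)) as [b [Hb0 Hbd]].
  assert (Ha : forall n, exists a, 0 < a /\ forall x, x < n -> Nat.divide (S (S x * b)) a).
  { induction n as [|n [a [Ha H]]]; [exists 1; split; lia|].
    exists (a * S (S n * b)). split; [nia|]. intros x Hx.
    destruct (Nat.eq_dec x n) as [->|]; [now exists a|].
    apply Nat.divide_mul_l, H; lia. }
  destruct (Ha (S cap)) as [a [Ha0 Had]].
  exists b, a. split; [exact Hb0|]. split; [exact Ha0|]. intros x Hx. split.
  - destruct (Hbd x) as [q Eq]; [lia|]. exists q. split; [nia|exact Eq].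
  - destruct (Had x) as [q Eq]; [lia|]. exists q. split; [nia|exact Eq].
Qed.

Lemma coprime_mul_r n m p : Nat.gcd n m = 1 -> Nat.gcd n p = 1 -> Nat.gcd n (m * p) = 1.
Proof.
  intros H1 H2. set (d := Nat.gcd n (m * p)).
  assert (Dn : Nat.divide d n) by apply Nat.gcd_divide_l.
  apply Nat.divide_1_r. rewrite <- H2. apply Nat.gcd_greatest; [exact Dn|].
  apply (Nat.gauss d m p); [apply Nat.gcd_divide_r|].
  apply Nat.divide_1_r. rewrite <- H1. apply Nat.gcd_greatest.
  - etransitivity; [apply Nat.gcd_divide_l|exact Dn].
  - apply Nat.gcd_divide_r.
Qed.

(** A common divisor divides y - x, which is y+1 times the modulus of [x] minus x+1 times the
    modulus of [y]. Since y - x divides [b], the common divisor divides [b] and hence 1. *)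
Lemma moduli_coprime cap b a x y :
  full cap b a -> x < y -> y <= cap -> Nat.gcd (S (S x * b)) (S (S y * b)) = 1.
Proof.
  intros (_ & _ & H) Hxy Hy.
  set (d := Nat.gcd _ _).
  destruct (Nat.gcd_divide_l (S (S x * b)) (S (S y * b))) as [u Hu].
  destruct (Nat.gcd_divide_r (S (S x * b)) (S (S y * b))) as [v Hv].
  fold d in Hu, Hv.
  assert (D1 : Nat.divide d (y - x)).
  { assert (E : S y * u * d = S x * v * d + (y - x)).
    { rewrite <- !Nat.mul_assoc, <- Hu, <- Hv. nia. }
    exists (S y * u - S x * v). rewrite Nat.mul_sub_distr_r. lia. }
  destruct (H (y - x - 1)) as [[q [_ Hq]] _]; [lia|].
  replace (S (y - x - 1)) with (y - x) in Hq by lia.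
  assert (D2 : Nat.divide d b) by (rewrite Hq; now apply Nat.divide_mul_r).
  assert (D3 : Nat.divide d (S x * b + 1)) by (exists u; lia).
  apply Nat.divide_add_cancel_r in D3; [|now apply Nat.divide_mul_r].
  now apply Nat.divide_1_r in D3.
Qed.

(** Take the product of the moduli of the chosen elements. Coprimality keeps it a divisor of [a],
    hence at most [a], and keeps every other modulus from dividing it. *)
Lemma full_sub cap b a (P : nat -> Prop) :
  full cap b a ->
  exists a', a' <= a /\ forall x, inset (cpair cap (cpair b a')) x <-> x <= cap /\ P x.
Proof.
  intros F. pose proof F as (Hb & Ha & Hd).
  set (m x := S (S x * b)).
  assert (C : forall x y, x <= cap -> y <= cap -> x <> y -> Nat.gcd (m x) (m y) = 1).
  { intros x y Hx Hy N. destruct (Nat.lt_gt_cases x y) as [[L|L] _]; [exact N| |].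
    - exact (moduli_coprime cap b a x y F L Hy).
    - rewrite Nat.gcd_comm. exact (moduli_coprime cap b a y x F L Hx). }
  assert (I : forall n, n <= S cap -> exists a', Nat.divide a' a /\
    (forall x, x < n -> P x -> Nat.divide (m x) a') /\
    (forall y, y <= cap -> n <= y \/ ~ P y -> Nat.gcd a' (m y) = 1)).
  { induction n as [|n IH]; intros Hn.
    - exists 1. split; [apply Nat.divide_1_l|]. split; [lia|]. intros; reflexivity.
    - destruct IH as (a' & H1 & H2 & H3); [lia|].
      destruct (classic (P n)) as [Hp|Hp].
      + exists (a' * m n). split; [|split].
        * assert (Dn : Nat.divide (m n) a).
          { destruct (Hd n) as [_ [q [_ Hq]]]; [lia|]. now exists q. }
          destruct Dn as [q Hq]. rewrite Hq. apply Nat.mul_divide_mono_r.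
          apply (Nat.gauss _ (m n)); [rewrite Nat.mul_comm, <- Hq; exact H1|].
          apply H3; [lia|now left].
        * intros x Hx Px. destruct (Nat.eq_dec x n) as [->|].
          -- now exists a'.
          -- apply Nat.divide_mul_l, H2; [lia|exact Px].
        * intros y Hy Hor.
          assert (y <> n) by (intros ->; destruct Hor; [lia|tauto]).
          rewrite Nat.gcd_comm. apply coprime_mul_r.
          -- rewrite Nat.gcd_comm. apply H3; [exact Hy|]. destruct Hor; [left; lia|now right].
          -- apply C; auto; lia.
      + exists a'. split; [exact H1|]. split.
        * intros x Hx Px. apply H2; [|exact Px]. destruct (Nat.eq_dec x n); [subst; tauto|lia].
        * intros y Hy Hor. apply H3; [exact Hy|].
          destruct (Nat.eq_dec y n) as [->|]; [now right|].
          destruct Hor; [left; lia|now right]. }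
  destruct (I (S cap)) as (a' & H1 & H2 & H3); [lia|].
  exists a'. split; [apply Nat.divide_pos_le; assumption|].
  intros x. rewrite inset_cpair. split.
  - intros [Hx D]. split; [exact Hx|]. apply NNPP; intros Np.
    specialize (H3 x Hx (or_intror Np)).
    assert (E : Nat.divide (m x) 1) by (rewrite <- H3; apply Nat.gcd_greatest; [exact D|apply Nat.divide_refl]).
    apply Nat.divide_1_r in E. unfold m in E. nia.
  - intros [Hx Px]. split; [exact Hx|]. apply H2; [lia|exact Px].
Qed.

Lemma inset_of_list l : exists k, forall x, inset k x <-> In x l.
Proof.
  destruct (full_ex (list_max l)) as (b & a & F).
  destruct (full_sub _ _ _ (fun x => In x l) F) as (a' & _ & H).
  exists (cpair (list_max l) (cpair b a')). intros x. rewrite H. split; [tauto|].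
  intros Hx. split; [|exact Hx].
  pose proof (proj1 (list_max_le l (list_max l)) (le_n _)) as M.
  rewrite Forall_forall in M. now apply M.
Qed.

(** * Inductive definitions are r.e. *)

(** One format for primitive recursion, substitution, numerals, provability and evaluation. A unary
    rule identifies its two premises or ignores one. *)
Inductive Ind (B : nat -> Prop) (R : nat -> nat -> nat -> Prop) : nat -> Prop :=
| ind_base x : B x -> Ind B R x
| ind_rule x y z : R x y z -> Ind B R y -> Ind B R z -> Ind B R x.

(* [cpair r x] in [D] says that [x] is derived with rank [r]. *)
Definition derivation (B : nat -> Prop) (R : nat -> nat -> nat -> Prop) (D : nat -> Prop) : Prop :=
  forall r x, D (cpair r x) -> B x \/
    exists y z, R x y z /\ (exists r1, r1 < r /\ D (cpair r1 y)) /\ (exists r2, r2 < r /\ D (cpair r2 z)).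

Lemma derivation_sound B R D r x : derivation B R D -> D (cpair r x) -> Ind B R x.
Proof.
  intros H. revert x. induction r as [r IH] using lt_wf_ind. intros x Hx.
  destruct (H r x Hx) as [Hb|(y & z & Hr & (r1 & L1 & H1) & (r2 & L2 & H2))].
  - now apply ind_base.
  - exact (ind_rule B R x y z Hr (IH _ L1 _ H1) (IH _ L2 _ H2)).
Qed.

Lemma derivation_complete B R x :
  Ind B R x -> exists l r, derivation B R (fun i => In i l) /\ In (cpair r x) l.
Proof.
  induction 1 as [x Hb|x y z Hr _ (l1 & r1 & D1 & H1) _ (l2 & r2 & D2 & H2)].
  - exists [cpair 0 x], 0. split; [|now left]. intros r x' [E|[]].
    apply cpair_inj in E as [_ <-]. now left.
  - exists (cpair (S (r1 + r2)) x :: l1 ++ l2), (S (r1 + r2)). split; [|now left].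
    assert (M : forall l, incl l (l1 ++ l2) -> derivation B R (fun i => In i l) ->
      forall r x', In (cpair r x') l -> B x' \/ exists y z, R x' y z /\
        (exists r3, r3 < r /\ In (cpair r3 y) (cpair (S (r1 + r2)) x :: l1 ++ l2)) /\
        (exists r4, r4 < r /\ In (cpair r4 z) (cpair (S (r1 + r2)) x :: l1 ++ l2))).
    { intros l Hl D r x' Hx'. destruct (D r x' Hx') as [Hb|(y' & z' & Hr' & (r3 & L3 & H3) & (r4 & L4 & H4))].
      - now left.
      - right. exists y', z'. split; [exact Hr'|].
        split; [exists r3|exists r4]; (split; [assumption|right; apply Hl; assumption]). }
    intros r x' [E|Hin].
    + apply cpair_inj in E as [<- <-]. right. exists y, z. split; [exact Hr|].
      split; [exists r1|exists r2]; (split; [lia|right; apply in_or_app; auto]).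
    + apply in_app_or in Hin as [Hin|Hin].
      * apply (M l1); [apply incl_appl, incl_refl|exact D1|exact Hin].
      * apply (M l2); [apply incl_appr, incl_refl|exact D2|exact Hin].
Qed.

Lemma S1_inset k x : F1 k -> F1 x -> S1 (fun e => inset (k e) (x e)).
Proof. apply S1_app2, S1_D0. auto with d0. Qed.

Lemma S1_notinset k x : F1 k -> F1 x -> S1 (fun e => ~ inset (k e) (x e)).
Proof. apply (S1_app2 (fun k x => ~ inset k x)), S1_D0. auto with d0. Qed.

#[global] Hint Resolve S1_inset S1_notinset : s1.

Lemma sublist_ex {X} (P : X -> Prop) l : exists l', forall i, In i l' <-> In i l /\ P i.
Proof.
  induction l as [|a l [l' IH]]; [exists []; cbn; tauto|].
  destruct (classic (P a)) as [Pa|Pa].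
  - exists (a :: l'). intros i; cbn. rewrite IH. intuition (subst; auto).
  - exists l'. intros i; cbn. rewrite IH. intuition (subst; auto; tauto).
Qed.

(** A finite derivation is coded by a number [k], and its correctness is a condition on the numbers
    up to [k]. This makes [Ind] r.e. as soon as its clauses are. *)
Lemma Ind_coded B R x :
  Ind B R x <-> exists k r, inset k (cpair r x) /\ forall i, i <= k -> ~ inset k i \/
    exists r x, i = cpair r x /\ (B x \/ exists y z, R x y z /\
      (exists r1, r1 < r /\ inset k (cpair r1 y)) /\ (exists r2, r2 < r /\ inset k (cpair r2 z))).
Proof.
  split.
  - intros H. apply derivation_complete in H as (l & r & D & Hx).
    (* Entries that are not pairs are dropped, because the coded version demands that every element
       of [k] be one. *)
    destruct (sublist_ex (fun i => exists r x, i = cpair r x) l) as [l' Hl'].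
    destruct (inset_of_list l') as [k Hk].
    assert (Hk' : forall r x, inset k (cpair r x) <-> In (cpair r x) l).
    { intros r' x'. rewrite Hk, Hl'. split; [tauto|]. eauto. }
    exists k, r. rewrite Hk'. split; [exact Hx|].
    intros i _. destruct (classic (inset k i)) as [Hi|Hi]; [right|now left].
    assert (Hi' := Hi). rewrite Hk, Hl' in Hi'. destruct Hi' as (_ & r' & x' & ->).
    exists r', x'. split; [reflexivity|]. rewrite Hk' in Hi. destruct (D r' x' Hi) as [|(y & z & Hr & (r1 & L1 & H1) & (r2 & L2 & H2))]; [now left|].
    right. exists y, z. split; [exact Hr|].
    split; [exists r1|exists r2]; rewrite Hk'; auto.
  - intros (k & r & Hx & H). apply (derivation_sound B R (inset k) r); [|exact Hx].
    intros r' x' Hi. destruct (H _ (inset_le _ _ Hi)) as [N|(r'' & x'' & E & Hor)]; [tauto|].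
    apply cpair_inj in E as [<- <-]. exact Hor.
Qed.

Lemma S1_Ind (B : nat -> (nat -> nat) -> Prop) (R : nat -> nat -> nat -> (nat -> nat) -> Prop) a :
  S1 (fun e => B (e 0) (fun n => e (S n))) ->
  S1 (fun e => R (e 0) (e 1) (e 2) (fun n => e (S (S (S n))))) ->
  F1 a ->
  S1 (fun e => Ind (fun x => B x e) (fun x y z => R x y z e) (a e)).
Proof.
  intros HB HR Ha.
  apply (S1_subst1 (fun x e => Ind (fun x => B x e) (fun x y z => R x y z e) x) a); [|exact Ha].
  eapply S1_ext; [intros e; symmetry; apply Ind_coded|].
  apply S1_ex, S1_ex. cbv beta. apply S1_and; [auto with s1|].
  apply S1_ball; [auto with s1|]. cbv beta. apply S1_or; [auto with s1|].
  apply S1_ex, S1_ex. cbv beta. apply S1_and; [auto with s1|]. apply S1_or.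
  - exact (S1_ren _ (fun n => match n with 0 => 0 | S m => S (S (S (S (S (S m))))) end) HB).
  - apply S1_ex, S1_ex. cbv beta. apply S1_and; [|auto 20 with s1].
    exact (S1_ren _ (fun n => match n with 0 => 2 | 1 => 1 | 2 => 0 | S (S (S m)) => S (S (S (S (S (S (S (S m))))))) end) HR).
Qed.

Lemma prec_fun_Ind g h n rest y :
  y = prec_fun g h (n :: rest) <->
  Ind (fun x => x = cpair 0 (g rest))
      (fun x y z => z = y /\ exists n r, y = cpair n r /\ x = cpair (S n) (h (n :: r :: rest)))
      (cpair n y).
Proof.
  unfold prec_fun; cbn [tl hd].
  set (f n := nat_rect (fun _ => nat) (g rest) (fun n r => h (n :: r :: rest)) n).
  change (y = f n <-> Ind (fun x => x = cpair 0 (f 0))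
    (fun x y z => z = y /\ exists n r, y = cpair n r /\ x = cpair (S n) (h (n :: r :: rest))) (cpair n y)).
  split.
  - intros ->. induction n as [|n IH]; [now apply ind_base|].
    apply (ind_rule _ _ _ (cpair n (f n)) (cpair n (f n))); [|exact IH|exact IH].
    split; [reflexivity|]. now exists n, (f n).
  - intros H. remember (cpair n y) as i eqn:Ei. revert n y Ei.
    induction H as [x ->|x y' z [-> (m & r & -> & ->)] _ IH _ _]; intros n y E;
      apply cpair_inj in E as [<- <-]; [reflexivity|].
    now rewrite (IH m r eq_refl).
Qed.

(** The arguments are functions of the environment instead of variables, so in a composition the
    inner functions simply become arguments of the outer one. *)
Lemma F1_PRf k g : PRf k g ->
  forall l : list ((nat -> nat) -> nat), length l = k -> Forall F1 l ->
  F1 (fun e => g (map (fun a => a e) l)).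
Proof.
  induction 1 as [k| |k i Hi|k g hs _ IHg _ IHh|k g h _ IHg _ IHh]; intros l Hl Fl.
  - apply F1_const.
  - destruct l as [|a [|b l]]; cbn in Hl; try lia. inversion Fl. now apply F1_S.
  - assert (E : (fun e => nth i (map (fun a => a e) l) 0) = nth i l (fun _ => 0)).
    { apply functional_extensionality; intros e. exact (map_nth (fun a => a e) l (fun _ => 0) i). }
    rewrite E. rewrite Forall_forall in Fl. apply Fl, nth_In. lia.
  - specialize (IHg (map (fun h e => h (map (fun a => a e) l)) hs)).
    rewrite length_map in IHg. specialize (IHg eq_refl).
    assert (E : (fun e => g (map (fun a => a e) (map (fun h e => h (map (fun a => a e) l)) hs))) =
      (fun e => g (map (fun h => h (map (fun a => a e) l)) hs))).
    { apply functional_extensionality; intros e. now rewrite map_map. }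
    rewrite E in IHg. apply IHg. apply Forall_forall. intros a Ha.
    apply in_map_iff in Ha as (h & <- & Hh). now apply IHh.
  - destruct l as [|a l]; cbn in Hl; [lia|]. inversion Fl as [|? ? Fa Fl']; subst.
    assert (Hg := IHg l ltac:(lia) Fl').
    (* Six variables precede the parameters: the two quantified in the rule, the three of the rule
       itself, and the value in the graph. *)
    set (r n := S (S (S (S (S (S n)))))).
    assert (Hh := IHh ((fun e => e 1) :: (fun e => e 0) :: map (fun a e => a (fun n => e (r n))) l)).
    cbn [length map] in Hh. rewrite length_map in Hh.
    assert (E : (fun e => h (e 1 :: e 0 :: map (fun a => a e) (map (fun a e => a (fun n => e (r n))) l))) =
      (fun e => h (e 1 :: e 0 :: map (fun a => a (fun n => e (r n))) l))).
    { apply functional_extensionality; intros e. now rewrite map_map. }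
    rewrite E in Hh. clear E.
    unfold F1. cbn [map].
    eapply S1_ext; [intros e; symmetry; apply prec_fun_Ind|].
    apply (S1_Ind
      (fun x e => x = cpair 0 (g (map (fun a => a (fun n => e (S n))) l)))
      (fun x y z e => z = y /\ exists n r, y = cpair n r /\
         x = cpair (S n) (h (n :: r :: map (fun a => a (fun n => e (S n))) l)))
      (fun e => cpair (a (fun n => e (S n))) (e 0))).
    + apply S1_eq; [apply F1_var|]. apply F1_cpair; [apply F1_const|].
      exact (F1_ren (fun n => S (S n)) _ Hg).
    + apply S1_and; [auto with s1|]. apply S1_ex, S1_ex. cbv beta.
      apply S1_and; [auto with s1|]. apply S1_eq; [apply F1_var|]. apply F1_cpair; [auto with s1|].
      apply Hh; [lia|]. repeat constructor; try apply F1_var.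
      apply Forall_forall. intros b Hb. apply in_map_iff in Hb as (c & <- & Hc).
      apply F1_ren. rewrite Forall_forall in Fl'. now apply Fl'.
    + apply F1_cpair; [|apply F1_var]. now apply F1_shift.
Qed.

(** * Codes of syntactic operations *)

Ltac cinj := repeat match goal with
  | H : cpair _ _ = cpair _ _ |- _ => apply cpair_inj in H; destruct H
  | H : ?x = ?x |- _ => clear H
  | _ => progress (try discriminate; subst)
  end.

Lemma tcode_inj t u : tcode t = tcode u -> t = u.
Proof.
  revert u; induction t; intros [] H; cbn [tcode] in H;
    apply cpair_inj in H as [E H]; try discriminate E; clear E.
  - congruence.
  - reflexivity.
  - now rewrite (IHt _ H).
  - apply cpair_inj in H as [H1 H2]. now rewrite (IHt1 _ H1), (IHt2 _ H2).
  - apply cpair_inj in H as [H1 H2]. now rewrite (IHt1 _ H1), (IHt2 _ H2).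
Qed.

Lemma fcode_inj p q : fcode p = fcode q -> p = q.
Proof.
  revert q; induction p; intros [] H; cbn [fcode] in H;
    apply cpair_inj in H as [E H]; try discriminate E; clear E.
  - reflexivity.
  - apply cpair_inj in H as [H1 H2]. now rewrite (tcode_inj _ _ H1), (tcode_inj _ _ H2).
  - apply cpair_inj in H as [H1 H2]. now rewrite (IHp1 _ H1), (IHp2 _ H2).
  - now rewrite (IHp _ H).
Qed.

(** Arbitrary substitutions are functions and have no codes. The logical axioms only shift or
    instantiate variable 0; under [k] binders these become the two families here, which are closed
    under [up]. *)
Definition shift_at (k n : nat) : term := if n <? k then tvar n else tvar (S n).
Definition inst_at (k : nat) (a : term) (n : nat) : term :=
  match lt_eq_lt_dec n k with inleft (left _) => tvar n | inleft (right _) => a | inright _ => tvar (pred n) end.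

Lemma inst_at_0 a : inst_at 0 a = inst0 a.
Proof.
  apply functional_extensionality; intros [|n]; unfold inst_at;
    destruct lt_eq_lt_dec as [[]|]; try lia; reflexivity.
Qed.

Lemma up_shift_at k : up (shift_at k) = shift_at (S k).
Proof.
  apply functional_extensionality; intros [|n]; [reflexivity|]. unfold shift_at; cbn [up].
  destruct (Nat.ltb_spec n k), (Nat.ltb_spec (S n) (S k)); try lia; reflexivity.
Qed.

Lemma up_inst_at k a : up (inst_at k a) = inst_at (S k) (tshift a).
Proof.
  apply functional_extensionality; intros [|n]; unfold inst_at; cbn [up].
  - destruct lt_eq_lt_dec as [[]|]; try lia; reflexivity.
  - destruct (lt_eq_lt_dec n k) as [[]|], (lt_eq_lt_dec (S n) (S k)) as [[]|]; try lia;
      try reflexivity. destruct n; [lia|reflexivity].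
Qed.

Definition subst_code (m : nat) (s : nat -> term) : Prop :=
  (exists k, m = cpair 0 k /\ s = shift_at k) \/
  (exists k a, m = cpair 1 (cpair k (tcode a)) /\ s = inst_at k a).

Definition VarC (m n y : nat) : Prop :=
  (exists k, m = cpair 0 k /\ ((n < k /\ y = cpair 0 n) \/ (k <= n /\ y = cpair 0 (S n)))) \/
  (exists k a, m = cpair 1 (cpair k a) /\
     ((n < k /\ y = cpair 0 n) \/ (n = k /\ y = a) \/ (exists j, n = S j /\ k <= j /\ y = cpair 0 j))).

Lemma VarC_iff m s n y : subst_code m s -> (VarC m n y <-> y = tcode (s n)).
Proof.
  intros [(k & -> & ->)|(k & a & -> & ->)]; split.
  - unfold shift_at. intros [(k' & E & H)|(k' & a' & E & _)]; cinj.
    destruct (Nat.ltb_spec n k'), H as [[]|[]]; try lia; assumption.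
  - intros ->. left. exists k. split; [reflexivity|]. unfold shift_at.
    destruct (Nat.ltb_spec n k); auto.
  - unfold inst_at. intros [(k' & E & _)|(k' & a' & E & H)]; cinj.
    destruct (lt_eq_lt_dec n k') as [[]|], H as [[]|[[]|(j & -> & ? & ->)]]; try lia; try assumption.
    reflexivity.
  - intros ->. right. exists k, (tcode a). split; [reflexivity|]. unfold inst_at.
    destruct (lt_eq_lt_dec n k) as [[]|]; auto.
    right; right. exists (pred n). split; [lia|]. split; [lia|reflexivity].
Qed.

Definition SubTB (i : nat) : Prop :=
  exists m x y, i = cpair m (cpair x y) /\
    ((x = cpair 1 0 /\ y = cpair 1 0) \/ exists n, x = cpair 0 n /\ VarC m n y).

Definition SubTR (i j k : nat) : Prop :=
  exists m x y x' y', j = cpair m (cpair x y) /\ k = cpair m (cpair x' y') /\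
    (i = cpair m (cpair (cpair 2 x) (cpair 2 y)) \/
     exists c, (c = 3 \/ c = 4) /\ i = cpair m (cpair (cpair c (cpair x x')) (cpair c (cpair y y')))).

Definition SubT (m x y : nat) : Prop := Ind SubTB SubTR (cpair m (cpair x y)).

Lemma SubT_sound m s x y : subst_code m s -> SubT m x y ->
  exists t, x = tcode t /\ y = tcode (tsubst s t).
Proof.
  intros Hm H. unfold SubT in H. remember (cpair m (cpair x y)) as i eqn:Ei.
  revert x y Ei. induction H as [i H|i j k H _ IH1 _ IH2]; intros x0 y0 E0.
  - destruct H as (m' & x & y & E & H). rewrite E0 in E. cinj.
    destruct H as [[-> ->]|(n & -> & H)].
    + now exists tzero.
    + exists (tvar n). split; [reflexivity|]. now apply (VarC_iff m' s).
  - destruct H as (m' & x & y & x' & y' & Ej & Ek & H). rewrite E0 in H.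
    assert (m' = m) as ->.
    { destruct H as [H|(c & _ & H)]; cinj; reflexivity. }
    destruct (IH1 _ _ Ej) as (t & Hx & Hy). destruct (IH2 _ _ Ek) as (u & Hx' & Hy').
    destruct H as [H|(c & [Hc|Hc] & H)]; apply cpair_inj in H as [_ H];
      apply cpair_inj in H as [-> ->]; rewrite Hx, Hy, ?Hx', ?Hy'.
    + now exists (tsucc t).
    + rewrite Hc. now exists (tplus t u).
    + rewrite Hc. now exists (tmult t u).
Qed.

Lemma SubT_complete m s t : subst_code m s -> SubT m (tcode t) (tcode (tsubst s t)).
Proof.
  intros Hm. unfold SubT. induction t; cbn [tcode tsubst].
  - apply ind_base. do 3 eexists. split; [reflexivity|]. right. eexists. split; [reflexivity|].
    now apply (VarC_iff m s).
  - apply ind_base. do 3 eexists. split; [reflexivity|]. left. split; reflexivity.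
  - eapply ind_rule; [|exact IHt|exact IHt]. do 5 eexists. do 2 (split; [reflexivity|]).
    left. reflexivity.
  - eapply ind_rule; [|exact IHt1|exact IHt2]. do 5 eexists. do 2 (split; [reflexivity|]).
    right. exists 3. split; [auto|reflexivity].
  - eapply ind_rule; [|exact IHt1|exact IHt2]. do 5 eexists. do 2 (split; [reflexivity|]).
    right. exists 4. split; [auto|reflexivity].
Qed.

Lemma subst_code_shift : subst_code (cpair 0 0) (fun n => tvar (S n)).
Proof. left. now exists 0. Qed.

Lemma subst_code_inst t : subst_code (cpair 1 (cpair 0 (tcode t))) (inst0 t).
Proof. right. exists 0, t. now rewrite inst_at_0. Qed.

(** Under a quantifier the term to be inserted must be shifted, which is itself an instance of
    [SubT]. *)
Definition UpC (m m' : nat) : Prop :=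
  (exists k, m = cpair 0 k /\ m' = cpair 0 (S k)) \/
  (exists k a b, m = cpair 1 (cpair k a) /\ m' = cpair 1 (cpair (S k) b) /\ SubT (cpair 0 0) a b).

Lemma UpC_sound m m' s : subst_code m s -> UpC m m' -> subst_code m' (up s).
Proof.
  intros [(k & -> & ->)|(k & a & -> & ->)] [(k' & E & ->)|(k' & a' & b & E & -> & H)]; cinj.
  - left. eexists. split; [reflexivity|]. apply up_shift_at.
  - right. apply (SubT_sound _ _ _ _ subst_code_shift) in H as (t & E & ->).
    apply tcode_inj in E as ->. do 2 eexists. split; [reflexivity|]. apply up_inst_at.
Qed.

Lemma UpC_complete m s : subst_code m s -> exists m', UpC m m'.
Proof.
  intros [(k & -> & ->)|(k & a & -> & ->)].
  - eexists. left. eexists. split; reflexivity.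
  - eexists. right. do 3 eexists. split; [reflexivity|]. split; [reflexivity|].
    exact (SubT_complete _ _ a subst_code_shift).
Qed.

Definition SubFB (i : nat) : Prop :=
  exists m x y, i = cpair m (cpair x y) /\
    ((x = cpair 0 0 /\ y = cpair 0 0) \/
     exists t u t' u', x = cpair 1 (cpair t u) /\ y = cpair 1 (cpair t' u') /\
       SubT m t t' /\ SubT m u u').

Definition SubFR (i j k : nat) : Prop :=
  exists m x y x' y', k = cpair m (cpair x' y') /\
    ((j = cpair m (cpair x y) /\
      i = cpair m (cpair (cpair 2 (cpair x x')) (cpair 2 (cpair y y')))) \/
     exists m', UpC m' m /\ i = cpair m' (cpair (cpair 3 x') (cpair 3 y'))).

Definition SubF (m x y : nat) : Prop := Ind SubFB SubFR (cpair m (cpair x y)).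

Lemma SubF_sound m s x y : subst_code m s -> SubF m x y ->
  exists p, x = fcode p /\ y = fcode (fsubst s p).
Proof.
  intros Hm H. unfold SubF in H. remember (cpair m (cpair x y)) as i eqn:Ei.
  revert m s x y Hm Ei. induction H as [i H|i j k H _ IH1 _ IH2]; intros m0 s x0 y0 Hm E0.
  - destruct H as (m' & x & y & E & H). rewrite E0 in E. cinj.
    destruct H as [[-> ->]|(t & u & t' & u' & -> & -> & Ht & Hu)].
    + now exists fbot.
    + apply (SubT_sound _ _ _ _ Hm) in Ht as (t0 & -> & ->).
      apply (SubT_sound _ _ _ _ Hm) in Hu as (u0 & -> & ->).
      now exists (feq t0 u0).
  - destruct H as (m & x & y & x' & y' & Ek & [[Ej H]|(m' & Hup & H)]); rewrite E0 in H;
      apply cpair_inj in H as [-> H]; apply cpair_inj in H as [-> ->].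
    + destruct (IH1 _ _ _ _ Hm Ej) as (p & -> & ->). destruct (IH2 _ _ _ _ Hm Ek) as (q & -> & ->).
      now exists (fimp p q).
    + destruct (IH2 _ _ _ _ (UpC_sound _ _ _ Hm Hup) Ek) as (p & -> & ->).
      now exists (fall p).
Qed.

Lemma SubF_complete p : forall m s, subst_code m s -> SubF m (fcode p) (fcode (fsubst s p)).
Proof.
  unfold SubF. induction p as [|t u|p IHp q IHq|p IHp]; intros m s Hm; cbn [fcode fsubst].
  - apply ind_base. do 3 eexists. split; [reflexivity|]. left. split; reflexivity.
  - apply ind_base. do 3 eexists. split; [reflexivity|]. right. do 4 eexists.
    do 2 (split; [reflexivity|]). split; now apply SubT_complete.
  - eapply ind_rule; [|exact (IHp _ _ Hm)|exact (IHq _ _ Hm)]. do 5 eexists.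
    split; [reflexivity|]. left. split; reflexivity.
  - destruct (UpC_complete _ _ Hm) as [m' Hup].
    pose proof (IHp _ _ (UpC_sound _ _ _ Hm Hup)) as H.
    eapply ind_rule; [|exact H|exact H]. exists m', 0, 0. do 2 eexists.
    split; [reflexivity|]. right. exists m. split; [exact Hup|reflexivity].
Qed.

Lemma SubF_iff m s p y : subst_code m s -> (SubF m (fcode p) y <-> y = fcode (fsubst s p)).
Proof.
  intros Hm; split.
  - intros H. apply (SubF_sound _ _ _ _ Hm) in H as (p' & E & ->). now apply fcode_inj in E as ->.
  - intros ->. now apply SubF_complete.
Qed.

(** The substitution relation is derivable only at codes of terms, so the domain of the shift
    recognizes them; likewise for formulas. *)
Definition TermC (x : nat) : Prop := exists y, SubT (cpair 0 0) x y.
Definition FormC (x : nat) : Prop := exists y, SubF (cpair 0 0) x y.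

Lemma TermC_iff x : TermC x <-> exists t, x = tcode t.
Proof.
  split.
  - intros [y H]. apply (SubT_sound _ _ _ _ subst_code_shift) in H as (t & -> & _). eauto.
  - intros [t ->]. eexists. exact (SubT_complete _ _ t subst_code_shift).
Qed.

Lemma FormC_iff x : FormC x <-> exists p, x = fcode p.
Proof.
  split.
  - intros [y H]. apply (SubF_sound _ _ _ _ subst_code_shift) in H as (p & -> & _). eauto.
  - intros [p ->]. eexists. exact (SubF_complete p _ _ subst_code_shift).
Qed.

Definition NumC (n c : nat) : Prop :=
  Ind (fun i => i = cpair 0 (cpair 1 0))
      (fun i j _ => exists n c, j = cpair n c /\ i = cpair (S n) (cpair 2 c)) (cpair n c).

Lemma NumC_iff n c : NumC n c <-> c = tcode (num n).
Proof.
  unfold NumC. split.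
  - intros H. remember (cpair n c) as i eqn:Ei. revert n c Ei.
    induction H as [i ->|i j k (n & c & -> & ->) _ IH _ _]; intros n0 c0 E; cinj; [reflexivity|].
    cbn. now rewrite (IH n c eq_refl).
  - intros ->. induction n as [|n IH]; [now apply ind_base|].
    eapply ind_rule; [|exact IH|exact IH]. now exists n, (tcode (num n)).
Qed.

Definition impC (x y : nat) : nat := cpair 2 (cpair x y).

Definition eq_axioms : list form :=
  [ feq (tvar 0) (tvar 0);
    fimp (feq (tvar 0) (tvar 1)) (fimp (feq (tvar 0) (tvar 2)) (feq (tvar 1) (tvar 2)));
    fimp (feq (tvar 0) (tvar 1)) (feq (tsucc (tvar 0)) (tsucc (tvar 1)));
    fimp (feq (tvar 0) (tvar 1)) (feq (tplus (tvar 0) (tvar 2)) (tplus (tvar 1) (tvar 2)));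
    fimp (feq (tvar 0) (tvar 1)) (feq (tplus (tvar 2) (tvar 0)) (tplus (tvar 2) (tvar 1)));
    fimp (feq (tvar 0) (tvar 1)) (feq (tmult (tvar 0) (tvar 2)) (tmult (tvar 1) (tvar 2)));
    fimp (feq (tvar 0) (tvar 1)) (feq (tmult (tvar 2) (tvar 0)) (tmult (tvar 2) (tvar 1))) ].

Definition LogAxC (x : nat) : Prop :=
  (exists p, In p eq_axioms /\ x = fcode p) \/
  exists p q r, FormC p /\ FormC q /\ FormC r /\
    (x = impC p (impC q p) \/
     x = impC (impC p (impC q r)) (impC (impC p q) (impC p r)) \/
     x = impC (impC (impC p (cpair 0 0)) (cpair 0 0)) p \/
     (exists t, TermC t /\ SubF (cpair 1 (cpair 0 t)) p q /\ x = impC (cpair 3 p) q) \/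
     (SubF (cpair 0 0) p r /\ x = impC (cpair 3 (impC r q)) (impC p (cpair 3 q)))).

Lemma LogAxC_iff x : LogAxC x <-> exists p, LogAx p /\ x = fcode p.
Proof.
  split.
  - intros [(p & H & ->)|(p & q & r & Hp & Hq & Hr & H)].
    + exists p. split; [|reflexivity].
      repeat (destruct H as [<-|H]; [constructor|]). destruct H.
    + apply FormC_iff in Hp as [p' ->]. apply FormC_iff in Hq as [q' ->].
      apply FormC_iff in Hr as [r' ->].
      destruct H as [H|[H|[H|[(t & Ht & Hs & H)|(Hs & H)]]]]; subst x.
      * exists (fimp p' (fimp q' p')). split; [constructor|reflexivity].
      * exists (fimp (fimp p' (fimp q' r')) (fimp (fimp p' q') (fimp p' r'))).
        split; [constructor|reflexivity].
      * exists (fimp (fneg (fneg p')) p'). split; [constructor|reflexivity].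
      * apply TermC_iff in Ht as [t' ->].
        apply (SubF_iff _ _ _ _ (subst_code_inst t')) in Hs. apply fcode_inj in Hs as ->.
        exists (fimp (fall p') (fsubst (inst0 t') p')). split; [constructor|reflexivity].
      * apply (SubF_iff _ _ _ _ subst_code_shift) in Hs. apply fcode_inj in Hs as ->.
        exists (fimp (fall (fimp (fshift p') q')) (fimp p' (fall q'))).
        split; [constructor|reflexivity].
  - intros (p0 & H & ->). assert (F : forall p, FormC (fcode p)) by (intros; apply FormC_iff; eauto).
    destruct H as [p q|p q r|p|p t|p q| | | | | | |];
      try (left; eexists; split; [|reflexivity]; cbn [In eq_axioms]; tauto); right.
    + exists (fcode p), (fcode q), (fcode q). do 3 (split; [apply F|]). now left.
    + exists (fcode p), (fcode q), (fcode r). do 3 (split; [apply F|]). right. now left.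
    + exists (fcode p), (fcode p), (fcode p). do 3 (split; [apply F|]). do 2 right. now left.
    + exists (fcode p), (fcode (fsubst (inst0 t) p)), (fcode p). do 3 (split; [apply F|]).
      do 3 right. left. exists (tcode t). split; [apply TermC_iff; eauto|].
      split; [apply SubF_complete, subst_code_inst|reflexivity].
    + exists (fcode p), (fcode q), (fcode (fshift p)). do 3 (split; [apply F|]).
      do 4 right. split; [apply (SubF_complete p), subst_code_shift|reflexivity].
Qed.

Definition ThC (axC : nat -> Prop) (x : nat) : Prop :=
  Ind (fun x => axC x \/ LogAxC x) (fun x y z => y = impC z x \/ x = cpair 3 y) x.

Lemma ThC_iff T axC x : (forall n, axC n <-> exists p, T p /\ fcode p = n) ->
  (ThC axC x <-> exists p, Prv T p /\ fcode p = x).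
Proof.
  intros Hax. split.
  - induction 1 as [x H|x y z H _ (p & Hp & Ep) _ (q & Hq & Eq)].
    + destruct H as [H|H].
      * apply Hax in H as (p & H & <-). exists p. split; [now apply prv_ax|reflexivity].
      * apply LogAxC_iff in H as (p & H & ->). exists p. split; [now apply prv_log|reflexivity].
    + destruct H as [->| ->].
      * destruct p as [| |p1 p2|]; cbn [fcode] in Ep; unfold impC in Ep;
          apply cpair_inj in Ep as [E Ep]; try discriminate E.
        apply cpair_inj in Ep as [E1 E2]. rewrite <- Eq in E1. apply fcode_inj in E1 as ->.
        exists p2. split; [eapply prv_mp; eassumption|exact E2].
      * exists (fall p). split; [now apply prv_gen|]. cbn. now rewrite Ep.
  - intros (p & H & <-). unfold ThC. induction H.
    + apply ind_base. left. apply Hax. eauto.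
    + apply ind_base. right. apply LogAxC_iff. eauto.
    + eapply ind_rule; [left; reflexivity|exact IHPrv1|exact IHPrv2].
    + eapply ind_rule; [right; reflexivity|exact IHPrv|exact IHPrv].
Qed.

(* [z] is the code of the formula coded by [d] with the numerals of [m] and then [n] put for its variables 0 and 1. *)
Definition Inst2C (d m n z : nat) : Prop :=
  exists c c' r, NumC m c /\ NumC n c' /\
    SubF (cpair 1 (cpair 0 c)) d r /\ SubF (cpair 1 (cpair 0 c')) r z.

Lemma Inst2C_iff p m n z :
  Inst2C (fcode p) m n z <-> z = fcode (Pr_at (fsubst (inst0 (num m)) p) n).
Proof.
  unfold Inst2C, Pr_at. split.
  - intros (c & c' & r & Hc & Hc' & H & H'). apply NumC_iff in Hc as ->, Hc' as ->.
    apply (SubF_iff _ _ _ _ (subst_code_inst _)) in H as ->.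
    now apply (SubF_iff _ _ _ _ (subst_code_inst _)) in H' as ->.
  - intros ->. exists (tcode (num m)), (tcode (num n)), (fcode (fsubst (inst0 (num m)) p)).
    split; [now apply NumC_iff|]. split; [now apply NumC_iff|].
    split; apply SubF_complete, subst_code_inst.
Qed.

Lemma S1_VarC m n y : F1 m -> F1 n -> F1 y -> S1 (fun e => VarC (m e) (n e) (y e)).
Proof. apply S1_app3. unfold VarC. auto 50 with s1. Qed.
#[global] Hint Resolve S1_VarC : s1.

Lemma S1_SubT m x y : F1 m -> F1 x -> F1 y -> S1 (fun e => SubT (m e) (x e) (y e)).
Proof.
  apply S1_app3. apply (S1_Ind (fun i _ => SubTB i) (fun i j k _ => SubTR i j k)).
  - unfold SubTB. auto 50 with s1.
  - unfold SubTR. auto 50 with s1.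
  - auto 50 with s1.
Qed.
#[global] Hint Resolve S1_SubT : s1.

Lemma S1_UpC m n : F1 m -> F1 n -> S1 (fun e => UpC (m e) (n e)).
Proof. apply S1_app2. unfold UpC. auto 50 with s1. Qed.
#[global] Hint Resolve S1_UpC : s1.

Lemma S1_SubF m x y : F1 m -> F1 x -> F1 y -> S1 (fun e => SubF (m e) (x e) (y e)).
Proof.
  apply S1_app3. apply (S1_Ind (fun i _ => SubFB i) (fun i j k _ => SubFR i j k)).
  - unfold SubFB. auto 50 with s1.
  - unfold SubFR. auto 50 with s1.
  - auto 50 with s1.
Qed.
#[global] Hint Resolve S1_SubF : s1.

Lemma S1_NumC m n : F1 m -> F1 n -> S1 (fun e => NumC (m e) (n e)).
Proof.
  apply S1_app2. apply (S1_Ind (fun i _ => i = cpair 0 (cpair 1 0))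
    (fun i j _ _ => exists n c, j = cpair n c /\ i = cpair (S n) (cpair 2 c))); auto 50 with s1.
Qed.
#[global] Hint Resolve S1_NumC : s1.

Lemma S1_LogAxC x : F1 x -> S1 (fun e => LogAxC (x e)).
Proof.
  apply S1_app1. unfold LogAxC. apply S1_or.
  - induction eq_axioms as [|p l IH].
    + apply (S1_ext (fun _ => False)); [|apply S1_Prop]. intros e; split; [tauto|intros (p & [] & _)].
    + apply (S1_ext (fun e => e 0 = fcode p \/ exists q, In q l /\ e 0 = fcode q)).
      * intros e; split; [intros [H|(q & H1 & H2)]|intros (q & [<-|H1] & H2)]; [| |auto|eauto].
        -- exists p. split; [now left|exact H].
        -- exists q. split; [now right|exact H2].
      * apply S1_or; [apply S1_eq; [apply F1_var|apply F1_const]|exact IH].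
  - unfold TermC, FormC, impC. auto 60 with s1.
Qed.
#[global] Hint Resolve S1_LogAxC : s1.

Lemma S1_ThC axC x : S1 (fun e => axC (e 0)) -> F1 x -> S1 (fun e => ThC axC (x e)).
Proof.
  intros Hax. apply S1_app1.
  apply (S1_Ind (fun x _ => axC x \/ LogAxC x) (fun x y z _ => y = impC z x \/ x = cpair 3 y)).
  - apply S1_or; [exact Hax|auto with s1].
  - unfold impC. auto 50 with s1.
  - auto with s1.
Qed.

(** * The shape of the provability predicate *)

Definition fand (p q : form) : form := fneg (fimp p (fneg q)).
Definition ballf (t : term) (p : form) : form := fall (fimp (fle (tvar 0) (tshift t)) p).
Definition f2 (p : form) (t u : term) : form := fsubst (t .: u .: tvar) p.
Definition f4 (p : form) (t u v w : term) : form := fsubst (t .: u .: v .: w .: tvar) p.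

Lemma f2_subst s p t u : fbound 2 p -> fsubst s (f2 p t u) = f2 p (tsubst s t) (tsubst s u).
Proof.
  intros H. unfold f2. rewrite fsubst_comp. apply (fsubst_ext_bound 2); [exact H|].
  intros [|[|n]] Hn; cbn; [reflexivity|reflexivity|lia].
Qed.

Lemma f4_subst s p t u v w : fbound 4 p ->
  fsubst s (f4 p t u v w) = f4 p (tsubst s t) (tsubst s u) (tsubst s v) (tsubst s w).
Proof.
  intros H. unfold f4. rewrite fsubst_comp. apply (fsubst_ext_bound 4); [exact H|].
  intros [|[|[|[|n]]]] Hn; cbn; try reflexivity; lia.
Qed.

Lemma ballf_subst s t p : fsubst s (ballf t p) = ballf (tsubst s t) (fsubst (up s) p).
Proof. unfold ballf; cbn [fsubst]. now rewrite fsubst_fle, <- tshift_up. Qed.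

Lemma fbound_f2 k p t u : fbound 2 p -> tbound k t -> tbound k u -> fbound k (f2 p t u).
Proof.
  intros H Ht Hu. apply (fbound_subst 2); [exact H|].
  intros [|[|n]] Hn; cbn; [exact Ht|exact Hu|lia].
Qed.

Lemma fbound_f4 k p t u v w : fbound 4 p ->
  tbound k t -> tbound k u -> tbound k v -> tbound k w -> fbound k (f4 p t u v w).
Proof.
  intros H Ht Hu Hv Hw. apply (fbound_subst 4); [exact H|].
  intros [|[|[|[|n]]]] Hn; cbn; try assumption; lia.
Qed.

Lemma fbound_ballf k t p : tbound k t -> fbound (S k) p -> fbound k (ballf t p).
Proof.
  intros Ht Hp. cbn. repeat split; auto; try lia.
  apply tbound_shift, tbound_shift, Ht.
Qed.

Lemma nd_and_intro {Ax} G p q : nd Ax G p -> nd Ax G q -> nd Ax G (fand p q).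
Proof.
  intros Hp Hq. apply nd_imp. apply (nd_mp _ q); [|apply nd_weak1, Hq].
  eapply nd_mp; [apply nd_self|apply nd_weak1, Hp].
Qed.

Lemma nd_and_l {Ax} G p q : nd Ax G (fand p q) -> nd Ax G p.
Proof.
  intros H. apply nd_contra. eapply nd_mp; [apply nd_weak1, H|].
  apply nd_imp. eapply nd_absurd; [apply nd_weak1, nd_self|apply nd_self].
Qed.

Lemma nd_and_r {Ax} G p q : nd Ax G (fand p q) -> nd Ax G q.
Proof.
  intros H. apply nd_contra. eapply nd_mp; [apply nd_weak1, H|].
  apply nd_imp, nd_weak1, nd_self.
Qed.

Lemma nd_ballf_inst {Ax} G t p u :
  nd Ax G (ballf t p) -> nd Ax G (fle u t) -> nd Ax G (fsubst (inst0 u) p).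
Proof.
  intros H. apply nd_mp. apply (nd_inst _ _ u) in H. cbn [fsubst] in H.
  rewrite fsubst_fle, tsubst_shift in H. change (tail (inst0 u)) with tvar in H.
  now rewrite tsubst_id in H.
Qed.

Lemma sat_ballf e t p : sat e (ballf t p) <-> forall x, x <= teval e t -> sat (x .: e) p.
Proof.
  apply Morphisms_Prop.all_iff_morphism; intros x.
  change ((sat (x .: e) (fle (tvar 0) (tshift t)) -> sat (x .: e) p) <-> (x <= teval e t -> sat (x .: e) p)).
  now rewrite sat_fle, teval_shift.
Qed.

Lemma sat_fand e p q : sat e (fand p q) <-> sat e p /\ sat e q.
Proof. cbn. tauto. Qed.

Section Skeleton.
Context {Fmem Feps Fring Frn : form}.

(** All quantifiers are bounded by the stage itself: the body of Pr stays bounded, and any given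
    standard edge comes into range once [t] is large. *)
Definition transfer (t e : term) : form :=
  let sh := tshift in
  ballf t (ballf (sh t) (ballf (sh (sh t))
    (fimp (f4 Feps (tvar 2) (tvar 1) (tvar 0) (sh (sh (sh e))))
      (fimp (f2 Fmem (sh (sh (sh t))) (tvar 1)) (f2 Fmem (sh (sh (sh t))) (tvar 0)))))).

(** The equation exempts [t] itself, so the first ringing stage remains usable while all later ones
    are blocked. *)
Definition unrung (t e : term) : form :=
  ballf t (fimp (f2 Fring (tvar 0) (tshift e)) (feq (tvar 0) (tshift t))).

Definition stage (t e x : term) : form :=
  fand (f2 Fmem t x) (fand (transfer t e) (fand (unrung t e) (f2 Frn t e))).

Context (Bmem : fbound 2 Fmem) (Beps : fbound 4 Feps) (Bring : fbound 2 Fring) (Brn : fbound 2 Frn).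

Lemma transfer_subst s t e : fsubst s (transfer t e) = transfer (tsubst s t) (tsubst s e).
Proof.
  unfold transfer. rewrite !ballf_subst. cbn [fsubst].
  rewrite f4_subst, !f2_subst by assumption. rewrite <- !tshift_up. reflexivity.
Qed.

Lemma unrung_subst s t e : fsubst s (unrung t e) = unrung (tsubst s t) (tsubst s e).
Proof.
  unfold unrung. rewrite !ballf_subst. cbn [fsubst].
  rewrite !f2_subst by assumption. rewrite <- !tshift_up. reflexivity.
Qed.

Lemma stage_subst s t e x :
  fsubst s (stage t e x) = stage (tsubst s t) (tsubst s e) (tsubst s x).
Proof.
  unfold stage. unfold fand, fneg. cbn [fsubst].
  now rewrite transfer_subst, unrung_subst, !f2_subst by assumption.
Qed.

Lemma fbound_stage k t e x : tbound k t -> tbound k e -> tbound k x -> fbound k (stage t e x).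
Proof.
  intros Ht He Hx. unfold stage, transfer, unrung.
  repeat first [apply conj | apply fbound_ballf | apply fbound_f2 | apply fbound_f4 | apply tbound_shift
    | assumption | exact I | (cbn; lia)].
Qed.

Lemma Delta0_stage t e x : Delta0 Fmem -> Delta0 Feps -> Delta0 Fring -> Delta0 Frn ->
  Delta0 (stage t e x).
Proof.
  intros. unfold stage, transfer, unrung, fand, fneg, ballf, f2, f4.
  repeat first [apply Delta0_subst; assumption | constructor].
Qed.

Lemma transfer_numerals G t e k n m :
  PA (f4 Feps (num k) (num n) (num m) (num e)) ->
  ndp G (transfer t (num e)) ->
  ndp G (fle (num k) t) -> ndp G (fle (num n) t) -> ndp G (fle (num m) t) ->
  ndp G (f2 Fmem t (num n)) -> ndp G (f2 Fmem t (num m)).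
Proof.
  intros Hed H Hk Hn Hm Hmem. unfold transfer in H. rewrite !tshift_num in H.
  assert (Es : forall u v, tsubst (inst0 v) (tshift u) = u).
  { intros u v. rewrite tsubst_shift. apply tsubst_id. }
  assert (Eu : forall u v, tsubst (up (inst0 v)) (tshift (tshift u)) = tshift u).
  { intros u v. now rewrite <- tshift_up, Es. }
  apply (nd_ballf_inst _ _ _ (num k)) in H; [|exact Hk].
  rewrite !ballf_subst, Es, Eu in H. cbn [fsubst] in H.
  rewrite f4_subst, !f2_subst, tsubst_num in H by assumption. cbn [tsubst up] in H.
  rewrite <- !tshift_up, Es, ?tshift_num in H.
  apply (nd_ballf_inst _ _ _ (num n)) in H; [|exact Hn].
  rewrite !ballf_subst, Es in H. cbn [fsubst] in H.
  rewrite f4_subst, !f2_subst, !tsubst_num in H by assumption. cbn [tsubst up inst0] in H.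
  rewrite <- !tshift_up, Es, ?tshift_num in H.
  apply (nd_ballf_inst _ _ _ (num m)) in H; [|exact Hm]. cbn [fsubst] in H.
  rewrite f4_subst, !f2_subst, !tsubst_num in H by assumption. cbn [tsubst inst0] in H.
  rewrite !Es in H.
  eapply nd_mp; [|exact Hmem]. eapply nd_mp; [exact H|]. now apply nd_of_Prv.
Qed.

Lemma stage_transfer G t e k n m K :
  PA (f4 Feps (num k) (num n) (num m) (num e)) -> k <= K -> n <= K -> m <= K ->
  ndp G (fle (num K) t) -> ndp G (stage t (num e) (num n)) -> ndp G (stage t (num e) (num m)).
Proof.
  intros Hed Hk Hn Hm HK H. unfold stage in *.
  apply nd_and_intro; [|exact (nd_and_r _ _ _ H)].
  apply (transfer_numerals G t e k n m Hed).
  - exact (nd_and_l _ _ _ (nd_and_r _ _ _ H)).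
  - exact (pa_le_num_trans _ _ _ _ Hk HK).
  - exact (pa_le_num_trans _ _ _ _ Hn HK).
  - exact (pa_le_num_trans _ _ _ _ Hm HK).
  - exact (nd_and_l _ _ _ H).
Qed.

(** By [unrung] a stage above the ringing [d] would equal [d]; the resulting d + 1 <= d is refuted
    by running through the numerals up to [d]. *)
Lemma stage_rung G t d e x :
  PA (f2 Fring (num d) (num e)) -> ndp G (fle (num (S d)) t) ->
  ndp G (stage t (num e) x) -> ndp G fbot.
Proof.
  intros Hr Hd H. unfold stage in H.
  apply nd_and_r, nd_and_r, nd_and_l in H. unfold unrung in H.
  apply (nd_ballf_inst _ _ _ (num d)) in H; [|exact (pa_le_num_trans _ _ _ _ (le_S _ _ (le_n d)) Hd)].
  cbn [fsubst] in H. rewrite f2_subst, tshift_num, tsubst_num in H by exact Bring. cbn [tsubst inst0] in H.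
  rewrite tsubst_shift in H. change (tail (inst0 (num d))) with tvar in H. rewrite tsubst_id in H.
  assert (E : ndp G (feq (num d) t)) by (eapply nd_mp; [exact H|now apply nd_of_Prv]).
  apply (pa_le_num_cases d G (num (S d))).
  - pose proof (nd_leibniz G (fle (tvar 1) (tvar 0)) t (num d) (num (S d) .: tvar) (nd_sym _ _ _ E)) as L.
    rewrite !fsubst_fle in L. exact (L Hd).
  - intros j Hj. eapply nd_absurd; [apply (pa_num_neq _ (S d) j); lia|apply nd_self].
Qed.

Context {Rmem Rring Rrn : nat -> nat -> Prop} {Reps : nat -> nat -> nat -> nat -> Prop}.
Context (Emem : forall e, sat e Fmem <-> Rmem (e 0) (e 1))
        (Eeps : forall e, sat e Feps <-> Reps (e 0) (e 1) (e 2) (e 3))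
        (Ering : forall e, sat e Fring <-> Rring (e 0) (e 1))
        (Ern : forall e, sat e Frn <-> Rrn (e 0) (e 1)).

Lemma sat_stage v t e x d E n :
  teval v t = d -> teval v e = E -> teval v x = n ->
  (sat v (stage t e x) <->
   Rmem d n /\
   (forall u, u <= d -> forall p, p <= d -> forall q, q <= d -> Reps u p q E -> Rmem d p -> Rmem d q) /\
   (forall b, b <= d -> Rring b E -> b = d) /\
   Rrn d E).
Proof.
  intros <- <- <-. unfold stage, transfer, unrung.
  repeat setoid_rewrite sat_fand. repeat setoid_rewrite sat_ballf.
  cbn [sat]. unfold f2, f4. repeat setoid_rewrite sat_subst.
  setoid_rewrite Emem. setoid_rewrite Eeps. setoid_rewrite Ering. setoid_rewrite Ern.
  cbn [scons]. repeat setoid_rewrite teval_shift. reflexivity.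
Qed.

End Skeleton.

(** * Stages *)

Section Stages.
Context (th : nat -> nat -> Prop) (ed : nat -> nat -> nat -> nat -> Prop) (ee : nat -> nat -> nat -> Prop).
Context (Dth : D0 (fun e => th (e 0) (e 1))) (Ded : D0 (fun e => ed (e 0) (e 1) (e 2) (e 3)))
        (Dee : D0 (fun e => ee (e 0) (e 1) (e 2))).

(* A stage [d] codes a finite set of pairs (rank, element). *)
Definition inrank (d r x : nat) : Prop := inset d (cpair r x).
Definition mem (d x : nat) : Prop := exists r, r <= d /\ inrank d r x.

(** The first argument of [th], [ed] and [ee] is the witness of an r.e. relation; bounding it gives
    the finite approximation of level [v]. *)
Definition edge_by (v E p q : nat) : Prop := exists w, w <= v /\ ed w E p q.

(** Ranks decrease along edges, so every element has a genuine derivation from theorems; without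
    ranks, elements could justify one another in a circle. *)
Definition norm (d E : nat) : Prop :=
  forall r, r <= d -> forall x, x <= d -> inrank d r x ->
    (exists w, w <= d /\ th w x) \/
    exists y, y <= d /\ ((exists r1, r1 <= d /\ r1 < r /\ inrank d r1 y) /\ edge_by d E y x).

Definition closed_by (v E d : nat) : Prop :=
  forall p, p <= v -> forall q, q <= v -> edge_by v E p q -> mem d p -> mem d q.

(* [F] bounds both a normal stage for level [v] and, being a full set, every stage with elements up to [v]. *)
Definition wit (E v F : nat) : Prop :=
  exists cap, cap <= F /\ exists b, b <= F /\ exists A, A <= F /\
    F = cpair cap (cpair b A) /\ (exists z, z <= cap /\ z = cpair 0 v) /\ full cap b A /\
    exists a, a <= A /\ exists d, d <= F /\ d = cpair cap (cpair b a) /\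
      norm d E /\ closed_by v E d /\
      forall x, x <= v -> (exists w, w <= v /\ th w x) -> mem d x.

(* The edges of level [v] are released only at numbers [u] exceeding a bound for the stages of level [v]. *)
Definition eps (u p q E : nat) : Prop :=
  exists v, v <= u /\ p <= v /\ q <= v /\ edge_by v E p q /\
    forall v', v' <= v -> exists F, F <= u /\ F < u /\ wit E v' F.

Definition clo (d E : nat) : Prop :=
  forall u, u <= d -> forall p, p <= d -> forall q, q <= d -> eps u p q E -> mem d p -> mem d q.

(** The assignment [s] is a set of pairs of a truth value and a number, read through [inrank].
    Demanding [clo] lets a ringing stage pass the clause [transfer]. The clause for value 0 also
    inspects earlier normal stages, so that no witness up to the first ring can activate a number
    assigned 0. *)
Definition ring (d E : nat) : Prop :=
  clo d E /\ exists s, s <= d /\ (exists w, w <= d /\ ee w E s) /\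
    forall n, n <= d ->
      (inrank s 1 n -> mem d n) /\
      (inrank s 0 n -> ~ mem d n /\
         forall d', d' <= d -> d' < d -> ~ (clo d' E /\ norm d' E /\ mem d' n)).

Definition active (d E : nat) : Prop := ring d E \/ norm d E.

Let D0_th a b : Tm a -> Tm b -> D0 (fun e => th (a e) (b e)).
Proof. apply D0_app2, Dth. Qed.
Let D0_ed a b c d : Tm a -> Tm b -> Tm c -> Tm d -> D0 (fun e => ed (a e) (b e) (c e) (d e)).
Proof. apply D0_app4, Ded. Qed.
Let D0_ee a b c : Tm a -> Tm b -> Tm c -> D0 (fun e => ee (a e) (b e) (c e)).
Proof. apply D0_app3, Dee. Qed.
#[local] Hint Resolve D0_th D0_ed D0_ee : d0.

Lemma D0_inrank d r x : Tm d -> Tm r -> Tm x -> D0 (fun e => inrank (d e) (r e) (x e)).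
Proof.
  apply D0_app3. apply (D0_ext (fun e => exists z, z <= e 0 /\ z = cpair (e 1) (e 2) /\ inset (e 0) z)).
  - intros e. split; [now intros (z & _ & -> & H)|].
    intros H. exists (cpair (e 1) (e 2)). split; [now apply inset_le|auto].
  - auto 20 with d0.
Qed.
#[local] Hint Resolve D0_inrank : d0.

Lemma D0_mem d x : Tm d -> Tm x -> D0 (fun e => mem (d e) (x e)).
Proof. apply D0_app2. unfold mem. auto 20 with d0. Qed.
#[local] Hint Resolve D0_mem : d0.

Lemma D0_edge_by v E p q : Tm v -> Tm E -> Tm p -> Tm q ->
  D0 (fun e => edge_by (v e) (E e) (p e) (q e)).
Proof. apply D0_app4. unfold edge_by. auto 20 with d0. Qed.
#[local] Hint Resolve D0_edge_by : d0.

Lemma D0_norm d E : Tm d -> Tm E -> D0 (fun e => norm (d e) (E e)).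
Proof. apply D0_app2. unfold norm. auto 30 with d0. Qed.
#[local] Hint Resolve D0_norm : d0.

Lemma D0_closed_by v E d : Tm v -> Tm E -> Tm d -> D0 (fun e => closed_by (v e) (E e) (d e)).
Proof. apply D0_app3. unfold closed_by. auto 30 with d0. Qed.
#[local] Hint Resolve D0_closed_by : d0.

Lemma D0_wit E v F : Tm E -> Tm v -> Tm F -> D0 (fun e => wit (E e) (v e) (F e)).
Proof. apply D0_app3. unfold wit. auto 60 with d0. Qed.
#[local] Hint Resolve D0_wit : d0.

Lemma D0_eps u p q E : Tm u -> Tm p -> Tm q -> Tm E -> D0 (fun e => eps (u e) (p e) (q e) (E e)).
Proof. apply D0_app4. unfold eps. auto 60 with d0. Qed.
#[local] Hint Resolve D0_eps : d0.

Lemma D0_clo d E : Tm d -> Tm E -> D0 (fun e => clo (d e) (E e)).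
Proof. apply D0_app2. unfold clo. auto 60 with d0. Qed.
#[local] Hint Resolve D0_clo : d0.

Lemma D0_ring d E : Tm d -> Tm E -> D0 (fun e => ring (d e) (E e)).
Proof. apply D0_app2. unfold ring. auto 60 with d0. Qed.
#[local] Hint Resolve D0_ring : d0.

Lemma D0_active d E : Tm d -> Tm E -> D0 (fun e => active (d e) (E e)).
Proof. apply D0_app2. unfold active. auto 60 with d0. Qed.

Lemma inrank_mem d r x : inrank d r x -> mem d x.
Proof.
  intros H. exists r. split; [|exact H].
  apply inset_le in H. pose proof (cpair_le_l r x). lia.
Qed.

Definition generated (v E : nat) (Z : nat -> Prop) : nat -> Prop :=
  Ind (fun x => x <= v /\ Z x) (fun x y z => z = y /\ x <= v /\ y <= v /\ edge_by v E y x).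

Lemma generated_le v E Z x : generated v E Z x -> x <= v.
Proof. intros H; destruct H; tauto. Qed.

Lemma derivations_union {B R} (P : nat -> Prop) n :
  (forall x, x < n -> P x -> Ind B R x) ->
  exists l, derivation B R (fun i => In i l) /\ forall x, x < n -> P x -> exists r, In (cpair r x) l.
Proof.
  induction n as [|n IH]; intros H.
  - exists []. split; [intros r x []|lia].
  - destruct IH as (l & D & Hl); [intros; apply H; [lia|assumption]|].
    destruct (classic (P n)) as [Pn|Pn].
    + destruct (derivation_complete _ _ _ (H n (le_n _) Pn)) as (l' & r & D' & Hr).
      exists (l ++ l'). split.
      * intros r0 x Hx. apply in_app_or in Hx as [Hx|Hx]; [apply D in Hx|apply D' in Hx];
          (destruct Hx as [Hx|(y & z & K1 & (r1 & L1 & K2) & (r2 & L2 & K3))]; [now left|]);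
          right; exists y, z; (split; [exact K1|]);
          (split; [exists r1|exists r2]; (split; [assumption|apply in_or_app; auto])).
      * intros x Hx Px. destruct (Nat.eq_dec x n) as [->|].
        -- exists r. apply in_or_app; auto.
        -- destruct (Hl x) as [r0 Hr0]; [lia|exact Px|]. exists r0. apply in_or_app; auto.
    + exists l. split; [exact D|]. intros x Hx Px.
      destruct (Nat.eq_dec x n) as [->|]; [tauto|]. apply Hl; [lia|exact Px].
Qed.

Lemma wit_ex E v : exists F, wit E v F.
Proof.
  set (Z x := exists w, w <= v /\ th w x).
  destruct (derivations_union (generated v E Z) (S v) (fun x _ H => H)) as (l & D & Hl).
  (* Room for the ranked derivations of the normal stage and, by [cpair 0 v], for any set of
     elements up to [v] placed at rank 0. *)
  set (cap := list_max l + cpair 0 v).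
  destruct (full_ex cap) as (b & A & HF).
  destruct (full_sub cap b A (fun i => In i l) HF) as (a & Ha & Hin).
  assert (Hin' : forall i, inset (cpair cap (cpair b a)) i <-> In i l).
  { intros i. rewrite Hin. split; [tauto|]. intros Hi. split; [|exact Hi].
    pose proof (proj1 (list_max_le l (list_max l)) (le_n _)) as M.
    rewrite Forall_forall in M. specialize (M i Hi). unfold cap. lia. }
  set (d := cpair cap (cpair b a)) in *.
  assert (Hmem : forall x, mem d x <-> generated v E Z x).
  { intros x. split.
    - intros (r & _ & Hr). apply Hin' in Hr. exact (derivation_sound _ _ _ _ _ D Hr).
    - intros Hx. destruct (Hl x) as [r Hr]; [apply generated_le in Hx; lia|exact Hx|].
      apply Hin' in Hr. exact (inrank_mem _ _ _ Hr). }
  assert (Hcap : cap <= d) by apply cpair_le_l.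
  assert (Hv : cpair 0 v <= d) by (unfold cap in Hcap; lia).
  pose proof (cpair_le_r 0 v) as Hv'.
  pose proof (cpair_le_r cap (cpair b A)). pose proof (cpair_le_l b A). pose proof (cpair_le_r b A).
  exists (cpair cap (cpair b A)). exists cap. split; [apply cpair_le_l|].
  exists b. split; [lia|]. exists A. split; [lia|]. split; [reflexivity|].
  split; [exists (cpair 0 v); unfold cap; split; [lia|reflexivity]|]. split; [exact HF|].
  exists a. split; [exact Ha|]. exists d.
  split; [unfold d; apply cpair_mono; [lia|]; apply cpair_mono; lia|]. split; [reflexivity|].
  split; [|split].
  - intros r _ x _ Hr. apply Hin' in Hr.
    destruct (D r x Hr) as [[_ (w & Hw & Hth)]|(y & z & (-> & Hx & Hy & w & Hw & Hed) & (r1 & L1 & K1) & _)].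
    + left. exists w. split; [lia|exact Hth].
    + right. exists y. split; [lia|]. apply Hin' in K1. split.
      * exists r1. split; [|split; [exact L1|exact K1]].
        apply inset_le in K1. pose proof (cpair_le_l r1 y). lia.
      * exists w. split; [lia|exact Hed].
  - intros p Hp q Hq He Hm. rewrite Hmem in *. eapply ind_rule; [|exact Hm|exact Hm]. auto.
  - intros x Hx Hw. apply Hmem. now apply ind_base.
Qed.

Lemma least_wit E v : exists F, wit E v F /\ forall F', F' < F -> ~ wit E v F'.
Proof.
  destruct (wit_ex E v) as [F HF].
  induction F as [F IH] using lt_wf_ind.
  destruct (classic (exists F', F' < F /\ wit E v F')) as [(F' & L & H)|N].
  - exact (IH F' L H).
  - exists F. split; [exact HF|]. intros F' L H. apply N. eauto.
Qed.

(** An edge in force at some [u <= d] has level below [v]: otherwise [eps], which asks for witnesses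
    at all levels up to its own, would supply one for [v] below [u <= F]. Closure under the edges of
    level [v] therefore covers it. *)
Lemma closed_clo E v F d :
  (forall F', F' < F -> ~ wit E v F') -> d <= F -> closed_by v E d -> clo d E.
Proof.
  intros HF Hd Hc u Hu p _ q _ (v0 & _ & Hp & Hq & (w & Hw & Hed) & Hwit) Hm.
  destruct (le_lt_dec v v0) as [L|L].
  - destruct (Hwit v L) as (F' & _ & HF' & H). exfalso. apply (HF F'); [lia|exact H].
  - apply (Hc p ltac:(lia) q ltac:(lia)); [|exact Hm]. exists w. split; [lia|exact Hed].
Qed.

Lemma normal_stage_ex E w x : th w x -> exists d, norm d E /\ clo d E /\ mem d x.
Proof.
  intros H. destruct (least_wit E (w + x)) as (F & HF & HL).
  pose proof HF as (cap & _ & b & _ & A & _ & _ & _ & _ & a & _ & d & Hd & _ & Hn & Hc & Ht).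
  exists d. split; [exact Hn|]. split; [exact (closed_clo _ _ _ _ HL Hd Hc)|].
  apply Ht; [lia|]. exists w. split; [lia|exact H].
Qed.

(** The stage need not be normal, so rank 0 serves for all elements. It fits below the least witness
    because that witness is a full set; this is why [wit] speaks of full sets and not merely of a
    bound for one normal stage. *)
Lemma generated_stage_ex E v Z : exists d, v <= d /\ clo d E /\ forall x, mem d x <-> generated v E Z x.
Proof.
  destruct (least_wit E v) as (F & HF & HL).
  pose proof HF as (cap & _ & b & _ & A & _ & EF & (z & Hz & Ez) & Hfull & _).
  destruct (full_sub cap b A (fun i => exists x, i = cpair 0 x /\ generated v E Z x) Hfull)
    as (a & Ha & Hin).
  set (d := cpair cap (cpair b a)) in *.
  pose proof (cpair_le_r 0 v) as Hv.
  assert (Hd : cap <= d) by apply cpair_le_l.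
  assert (Hmem : forall x, mem d x <-> generated v E Z x).
  { intros x. split.
    - intros (r & _ & Hr). apply Hin in Hr as (_ & x' & Ex & Hx).
      apply cpair_inj in Ex as [_ <-]. exact Hx.
    - intros Hx. apply (inrank_mem d 0). apply Hin. split; [|eauto].
      pose proof (cpair_mono 0 x 0 v (le_n _) (generated_le _ _ _ _ Hx)). lia. }
  exists d. split; [lia|]. split; [|exact Hmem].
  apply (closed_clo E v F); [exact HL| |].
  - rewrite EF. apply cpair_mono; [lia|]. apply cpair_mono; lia.
  - intros p Hp q Hq He Hm. rewrite Hmem in *. eapply ind_rule; [|exact Hm|exact Hm]. auto.
Qed.

(** Release is delayed but never cancelled: witnesses for the finitely many levels up to [v] have a
    common bound. *)
Lemma eps_ex E w p q : ed w E p q -> exists u, eps u p q E.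
Proof.
  intros H. set (v := w + p + q).
  destruct (bounded_collection (fun v' F => wit E v' F) v) as [W HW].
  { intros v' _. apply wit_ex. }
  exists (S (W + v)). exists v. split; [lia|]. split; [lia|]. split; [lia|]. split.
  - exists w. split; [lia|exact H].
  - intros v' Hv'. destruct (HW v' Hv') as (F & HF & Hw). exists F. split; [lia|].
    split; [lia|exact Hw].
Qed.

End Stages.

(** * The provability predicate *)

(** Codes of formulas are pairs with tag at most 3. The test on the tag leaves the numbers that
    interpret variables without outgoing edges; otherwise the interpretation of p -> Box p would be
    provable for every variable p. *)
Definition edgeC (axC : nat -> Prop) (L : logic) (E p q : nat) : Prop :=
  ThC axC (impC p q) \/
  (L = MNF /\ (exists t r, t <= 3 /\ p = cpair t r) /\ Inst2C E E p q).

(* [evalC E s (cpair b x)]: under the assignment [s] to the atoms Pr(n), the formula with code [x] has truth value [b]. *)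
Definition evalC (E s i : nat) : Prop :=
  Ind (fun i => i = cpair 0 (fcode (feq tzero (tsucc tzero))) \/
         exists b n x, i = cpair b x /\ inset s (cpair b n) /\ Inst2C E E n x)
      (fun i j k => exists p q,
         (i = cpair 1 (impC p q) /\ (j = cpair 0 p \/ j = cpair 1 q)) \/
         (i = cpair 0 (impC p q) /\ j = cpair 1 p /\ k = cpair 0 q)) i.

Definition refutedC (axC : nat -> Prop) (E s : nat) : Prop :=
  exists x, ThC axC x /\ evalC E s (cpair 0 x).

Lemma S1_edgeC axC L : S1 (fun e => axC (e 0)) -> S1 (fun e => edgeC axC L (e 0) (e 1) (e 2)).
Proof.
  intros Hax. unfold edgeC. apply S1_or.
  - apply S1_ThC; [exact Hax|]. unfold impC. auto with s1.
  - apply S1_and; [apply S1_Prop|]. unfold Inst2C. auto 60 with s1.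
Qed.

Lemma S1_refutedC axC : S1 (fun e => axC (e 0)) -> S1 (fun e => refutedC axC (e 0) (e 1)).
Proof.
  intros Hax. unfold refutedC. apply S1_ex. cbv beta.
  apply S1_and; [apply S1_ThC; [exact Hax|auto with s1]|].
  unfold evalC. apply (S1_Ind (fun i e => i = cpair 0 (fcode (feq tzero (tsucc tzero))) \/
      exists b n x, i = cpair b x /\ inset (e 2) (cpair b n) /\ Inst2C (e 1) (e 1) n x)
    (fun i j k _ => exists p q,
      (i = cpair 1 (impC p q) /\ (j = cpair 0 p \/ j = cpair 1 q)) \/
      (i = cpair 0 (impC p q) /\ j = cpair 1 p /\ k = cpair 0 q))).
  - apply S1_or; [apply S1_eq; [apply F1_var|apply F1_const]|]. unfold Inst2C. auto 60 with s1.
  - unfold impC. auto 60 with s1.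
  - auto with s1.
Qed.

(** The remaining variables are set to 0, which leaves a bounded relation of the witness and the
    displayed arguments alone. *)
Lemma S1_staged1 (P : nat -> Prop) : S1 (fun e => P (e 0)) ->
  exists Q, D0 (fun e => Q (e 0) (e 1)) /\ forall x, P x <-> exists w, Q w x.
Proof.
  intros [R [H1 H2]]. exists (fun w x => R (w .: x .: fun _ => 0)). split.
  - apply (D0_subst _ (tvar 0 .: tvar 1 .: fun _ => tzero)) in H1. revert H1. apply D0_ext.
    intros e. match goal with |- R ?f <-> R ?g => replace f with g; [tauto|] end.
    apply functional_extensionality; intros [|[|n]]; reflexivity.
  - intros x. exact (H2 (x .: fun _ => 0)).
Qed.

Lemma S1_staged2 (P : nat -> nat -> Prop) : S1 (fun e => P (e 0) (e 1)) ->
  exists Q, D0 (fun e => Q (e 0) (e 1) (e 2)) /\ forall x y, P x y <-> exists w, Q w x y.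
Proof.
  intros [R [H1 H2]]. exists (fun w x y => R (w .: x .: y .: fun _ => 0)). split.
  - apply (D0_subst _ (tvar 0 .: tvar 1 .: tvar 2 .: fun _ => tzero)) in H1. revert H1. apply D0_ext.
    intros e. match goal with |- R ?f <-> R ?g => replace f with g; [tauto|] end.
    apply functional_extensionality; intros [|[|[|n]]]; reflexivity.
  - intros x y. exact (H2 (x .: y .: fun _ => 0)).
Qed.

Lemma S1_staged3 (P : nat -> nat -> nat -> Prop) : S1 (fun e => P (e 0) (e 1) (e 2)) ->
  exists Q, D0 (fun e => Q (e 0) (e 1) (e 2) (e 3)) /\ forall x y z, P x y z <-> exists w, Q w x y z.
Proof.
  intros [R [H1 H2]]. exists (fun w x y z => R (w .: x .: y .: z .: fun _ => 0)). split.
  - apply (D0_subst _ (tvar 0 .: tvar 1 .: tvar 2 .: tvar 3 .: fun _ => tzero)) in H1. revert H1. apply D0_ext.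
    intros e. match goal with |- R ?f <-> R ?g => replace f with g; [tauto|] end.
    apply functional_extensionality; intros [|[|[|[|n]]]]; reflexivity.
  - intros x y z. exact (H2 (x .: y .: z .: fun _ => 0)).
Qed.

Lemma D0_formula k R : D0 R ->
  (forall e, R e <-> R (fun n => if n <? k then e n else 0)) ->
  exists p, Delta0 p /\ fbound k p /\ forall e, sat e p <-> R e.
Proof.
  intros [p [H1 H2]] HR.
  exists (fsubst (fun n => if n <? k then tvar n else tzero) p). split; [|split].
  - now apply Delta0_subst.
  - destruct (fbound_ex p) as [l Hl]. apply (fbound_subst l); [exact Hl|].
    intros n _. destruct (Nat.ltb_spec n k); cbn; auto.
  - intros e. rewrite sat_subst, H2, (HR e).
    match goal with |- R ?f <-> R ?g => replace f with g; [tauto|] end.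
    apply functional_extensionality; intros n. cbv beta. destruct (n <? k); reflexivity.
Qed.

Section Predicate.
Context (T : form -> Prop) (L : logic) (axC : nat -> Prop).
Context (Hax : forall n, axC n <-> exists p, T p /\ fcode p = n)
        (Hext : extends_PA T) (Hcon : consistent T).
Context (th : nat -> nat -> Prop) (ed : nat -> nat -> nat -> nat -> Prop) (ee : nat -> nat -> nat -> Prop).
Context (Hth : forall x, ThC axC x <-> exists w, th w x)
        (Hed : forall E p q, edgeC axC L E p q <-> exists w, ed w E p q)
        (Hee : forall E s, refutedC axC E s <-> exists w, ee w E s).
Context (Fmem Feps Fring Fact : form).
Context (Dmem : Delta0 Fmem) (Deps : Delta0 Feps) (Dring : Delta0 Fring) (Dact : Delta0 Fact)
        (Bmem : fbound 2 Fmem) (Beps : fbound 4 Feps) (Bring : fbound 2 Fring) (Bact : fbound 2 Fact)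
        (Emem : forall e, sat e Fmem <-> mem (e 0) (e 1))
        (Eeps : forall e, sat e Feps <-> eps th ed (e 0) (e 1) (e 2) (e 3))
        (Ering : forall e, sat e Fring <-> ring th ed ee (e 0) (e 1))
        (Eact : forall e, sat e Fact <-> active th ed ee (e 0) (e 1)).

Notation Stage := (@stage Fmem Feps Fring Fact).

(** Self-reference as in the diagonal lemma: variable 0 stands for a code, [Prov] puts in the
    numeral of the code of [preds] itself, and [Inst2C E E n] then computes the code of Pr(n). *)
Definition preds : form := fex (Stage (tvar 0) (tvar 1) (tvar 2)).

Context (E : nat) (HE : E = fcode preds).

Definition Prov : form := fsubst (inst0 (num E)) preds.

Notation Ring d := (ring th ed ee d E).
Notation Clo d := (clo th ed d E).
Notation Norm d := (norm th ed d E).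

Lemma Prov_at n : Pr_at Prov n = fex (Stage (tvar 0) (num E) (num n)).
Proof.
  unfold Pr_at, Prov, preds. rewrite !fsubst_fex, !stage_subst by assumption.
  cbn [tsubst up inst0]. unfold tshift. cbn [tsubst up inst0]. unfold tshift.
  now rewrite !tsubst_num.
Qed.

Lemma Prov_Sigma1 : Sigma1 Prov.
Proof.
  unfold Prov, preds. rewrite fsubst_fex. apply s1_ex, s1_d0, Delta0_subst.
  now apply Delta0_stage.
Qed.

Lemma Prov_bound : fbound 1 Prov.
Proof.
  apply (fbound_subst 2).
  - refine (conj (conj _ I) I). apply fbound_stage; cbn; auto; lia.
  - intros [|n] Hn; cbn; [apply tbound_num|lia].
Qed.

Lemma Prov_sentence n : sentence (Pr_at Prov n).
Proof.
  apply (fbound_subst 1); [apply Prov_bound|]. intros [|m] Hm; cbn; [apply tbound_num|lia].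
Qed.

Lemma Inst2C_Prov n z : Inst2C E E n z <-> z = fcode (Pr_at Prov n).
Proof. rewrite HE at 1. apply Inst2C_iff. Qed.

Definition good (d n : nat) : Prop :=
  mem d n /\ Clo d /\ (forall b, b <= d -> Ring b -> b = d) /\ active th ed ee d E.

Lemma sat_Stage e d n : sat e (Stage (num d) (num E) (num n)) <-> good d n.
Proof. apply (sat_stage Emem Eeps Ering Eact); apply teval_num. Qed.

Lemma Stage_numv e d n : fsubst (numv e) (Stage (num d) (num E) (num n)) = Stage (num d) (num E) (num n).
Proof. rewrite stage_subst by assumption. now rewrite !tsubst_num. Qed.

Lemma Stage_true d n : good d n -> PA (Stage (num d) (num E) (num n)).
Proof.
  intros H. rewrite <- (Stage_numv (fun _ => 0)). refine (proj1 (Delta0_decide (Stage (num d) (num E) (num n)) _ _) _).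
  - now apply Delta0_stage.
  - now apply sat_Stage.
Qed.

Lemma Stage_false d n : ~ good d n -> PA (fneg (Stage (num d) (num E) (num n))).
Proof.
  intros H. rewrite <- (Stage_numv (fun _ => 0)). refine (proj2 (Delta0_decide (Stage (num d) (num E) (num n)) _ _) _).
  - now apply Delta0_stage.
  - now rewrite sat_Stage.
Qed.

Lemma Prov_true d n : good d n -> PA (Pr_at Prov n).
Proof.
  intros H. rewrite Prov_at. apply (nd_ex (Ax := PAax) [] _ (num d)).
  rewrite stage_subst by assumption. cbn [tsubst inst0]. rewrite !tsubst_num.
  now apply Stage_true.
Qed.

Lemma Prov_good n : PA (Pr_at Prov n) -> exists d, good d n.
Proof.
  intros H. apply PA_sound with (e := fun _ => 0) in H. rewrite Prov_at in H.
  apply sat_fex in H as [d H]. exists d.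
  now apply (sat_stage Emem Eeps Ering Eact _ _ _ _ d E n) in H; rewrite ?teval_num.
Qed.

(* Inside PA the witness of Pr(n) is a standard number below [K], for which the stage formula is decided, or at least [K]. *)
Lemma Prov_elim n K q :
  (forall j, j < K -> good j n -> PA q) ->
  ndp [fle (num K) (tvar 0); Stage (tvar 0) (num E) (num n)] (fshift q) ->
  PA (fimp (Pr_at Prov n) q).
Proof.
  intros Hj HK. apply (nd_imp (Ax := PAax) []). rewrite Prov_at.
  eapply nd_ex_elim; [apply nd_self|].
  eapply (nd_weak [Stage (tvar 0) (num E) (num n)]); [intros x [<-|[]]; now left|].
  apply (pa_num_split K _ (tvar 0)); [|exact HK].
  intros j Hlt. destruct (classic (good j n)) as [G|G].
  - apply nd_of_Prv. apply (Prv_subst shift_var). now apply (Hj j).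
  - apply nd_exfalso. eapply nd_mp; [apply nd_of_Prv, (Stage_false j n G)|].
    pose proof (nd_leibniz (Ax := PAax) [feq (tvar 0) (num j); Stage (tvar 0) (num E) (num n)]
      (Stage (tvar 0) (num E) (num n)) (tvar 0) (num j) tvar (nd_self _ _)) as H.
    rewrite !stage_subst in H by assumption. cbn [tsubst scons] in H. rewrite !tsubst_num in H.
    apply H, nd_weak1, nd_self.
Qed.

Lemma Prv_of_PA p : PA p -> Prv T p.
Proof. exact (nd_mono _ _ [] p Hext). Qed.

Lemma ThC_spec x : ThC axC x <-> exists p, Prv T p /\ fcode p = x.
Proof. now apply ThC_iff. Qed.

(** * What PA decides at the first ring *)

Section FirstRing.
Context (d s : nat) (Hring : Ring d) (Hleast : forall b, b < d -> ~ Ring b).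
Context (Hs : s <= d) (Hclo : Clo d).
Context (Hcheck : forall n, n <= d ->
      (inrank s 1 n -> mem d n) /\
      (inrank s 0 n -> ~ mem d n /\ forall d', d' <= d -> d' < d -> ~ (Clo d' /\ Norm d' /\ mem d' n))).

(** The ringing stage is itself the witness: it is active by ringing, and [unrung] exempts it. *)
Lemma first_ring_true n : inrank s 1 n -> PA (Pr_at Prov n).
Proof.
  intros H. apply (Prov_true d). split; [|split; [exact Hclo|split; [|now left]]].
  - apply Hcheck; [|exact H]. apply inset_le in H. pose proof (cpair_le_r 1 n). lia.
  - intros b Hb Rb. destruct (Nat.eq_dec b d); [assumption|]. exfalso. apply (Hleast b); [lia|exact Rb].
Qed.

(** A witness below [d] does not ring, so it is normal and the ring has excluded it; [d] does not
    contain [n]; a witness above [d] contradicts [unrung]. *)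
Lemma first_ring_false n : inrank s 0 n -> PA (fneg (Pr_at Prov n)).
Proof.
  intros H.
  destruct (Hcheck n) as [_ Hneg].
  { apply inset_le in H. pose proof (cpair_le_r 0 n). lia. }
  destruct (Hneg H) as [N1 N2].
  apply (Prov_elim n (S d)).
  - intros j Hj (Hm & Hc & _ & [Hr|Hn]); exfalso.
    + destruct (Nat.eq_dec j d) as [->|]; [exact (N1 Hm)|]. apply (Hleast j); [lia|exact Hr].
    + destruct (Nat.eq_dec j d) as [->|]; [exact (N1 Hm)|].
      apply (N2 j); [lia|lia|]. auto.
  - apply (@stage_rung Fmem Feps Fring Fact Bring _ (tvar 0) d E (num n)).
    + assert (Hf : PA (fsubst (numv (d .: E .: fun _ => 0)) Fring)).
      { refine (proj1 (Delta0_decide Fring Dring _) _). now apply Ering. }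
      unfold f2. erewrite fsubst_ext_bound; [exact Hf|exact Bring|].
      intros [|[|m]] Hm; try reflexivity. lia.
    + apply nd_self.
    + apply nd_weak1, nd_self.
Qed.

(** PA follows the evaluation rule by rule. Both truth values are carried through one induction,
    since the rules for an implication have premises of either value. *)
Lemma first_ring_eval i : evalC E s i -> forall x p,
  fcode p = x -> (i = cpair 1 x -> PA p) /\ (i = cpair 0 x -> PA (fneg p)).
Proof.
  induction 1 as [i H|i j k (p & q & H) _ IH1 _ IH2]; intros x p0 Hp.
  - destruct H as [->|(b & n & y & -> & Hin & Hy)].
    + split; intros H; apply cpair_inj in H as [H1 H2]; [discriminate H1|].
      rewrite <- Hp in H2. apply fcode_inj in H2 as <-. exact (pa_num_neq [] 0 1 ltac:(lia)).
    + apply Inst2C_Prov in Hy.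
      split; intros H; apply cpair_inj in H as [-> H2]; rewrite H2, <- Hp in Hy;
        apply fcode_inj in Hy as ->; [now apply first_ring_true|now apply first_ring_false].
  - assert (Hpq : forall b, i = cpair b x -> i = cpair 1 (impC p q) \/ i = cpair 0 (impC p q) ->
        exists p1 q1, p0 = fimp p1 q1 /\ fcode p1 = p /\ fcode q1 = q).
    { intros b H1 H2. assert (Ex : x = impC p q).
      { rewrite H1 in H2. destruct H2 as [H2|H2]; now apply cpair_inj in H2. }
      rewrite <- Hp in Ex. unfold impC in Ex. destruct p0 as [| |p1 q1|]; cbn [fcode] in Ex;
        apply cpair_inj in Ex as [E1 E2]; try discriminate E1.
      apply cpair_inj in E2 as [? ?]. eauto. }
    split; intros Hi.
    + destruct (Hpq 1 Hi) as (p1 & q1 & -> & Hp1 & Hq1); [destruct H as [[H _]|[H _]]; auto|].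
      destruct H as [[_ [Hj|Hj]]|[H _]].
      * apply (proj2 (IH1 p p1 Hp1)) in Hj.
        apply (nd_imp (Ax := PAax) []). eapply nd_absurd; [exact (nd_of_Prv _ _ Hj)|apply nd_self].
      * apply (proj1 (IH1 q q1 Hq1)) in Hj. apply (nd_imp (Ax := PAax) []). now apply nd_of_Prv.
      * rewrite Hi in H. apply cpair_inj in H as [H _]. discriminate H.
    + destruct (Hpq 0 Hi) as (p1 & q1 & -> & Hp1 & Hq1); [destruct H as [[H _]|[H _]]; auto|].
      destruct H as [[H _]|[_ [Hj Hk]]].
      * rewrite Hi in H. apply cpair_inj in H as [H _]. discriminate H.
      * apply (proj1 (IH1 p p1 Hp1)) in Hj. apply (proj2 (IH2 q q1 Hq1)) in Hk.
        apply (nd_imp (Ax := PAax) []). eapply nd_mp; [exact (nd_of_Prv _ _ Hk)|].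
        eapply nd_mp; [apply nd_self|exact (nd_of_Prv _ _ Hj)].
Qed.

End FirstRing.

(* At the first ring PA would refute a theorem of T. *)
Lemma no_ring d : ~ Ring d.
Proof.
  induction d as [d IH] using lt_wf_ind. intros Hring.
  pose proof Hring as (Hclo & s & Hs & (w & _ & Hw) & Hcheck).
  assert (Hr : refutedC axC E s) by (apply Hee; eauto).
  destruct Hr as (x & Hx & Hev). apply ThC_spec in Hx as (p & Hp & Ep).
  pose proof (proj2 (first_ring_eval d s Hring IH Hs Hclo Hcheck _ Hev x p Ep) eq_refl) as N.
  apply Hcon. exact (prv_mp _ _ _ (Prv_of_PA _ N) Hp).
Qed.

Lemma normal_good d n : Norm d -> Clo d -> mem d n -> good d n.
Proof.
  intros Hn Hc Hm. split; [exact Hm|]. split; [exact Hc|]. split; [|now right].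
  intros b _ Rb. exfalso. exact (no_ring b Rb).
Qed.

Lemma theorem_edge p q : ThC axC (impC p q) ->
  (exists a, Prv T a /\ fcode a = p) -> exists b, Prv T b /\ fcode b = q.
Proof.
  intros H (a & Ha & Ea). apply ThC_spec in H as (c & Hc & Ec). unfold impC in Ec.
  destruct c as [| |c1 c2|]; cbn [fcode] in Ec; apply cpair_inj in Ec as [E1 E2]; try discriminate E1.
  apply cpair_inj in E2 as [E2 E3]. rewrite <- Ea in E2. apply fcode_inj in E2 as ->.
  exists c2. split; [exact (prv_mp _ _ _ Hc Ha)|exact E3].
Qed.

(** No stage rings, so a good stage is normal and induction on the rank applies. For an edge from
    [y] to Pr(y) the same stage, which contains [y], is the witness by which PA proves Pr(y). *)
Lemma good_theorem d n : good d n -> exists p, Prv T p /\ fcode p = n.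
Proof.
  intros (Hm & Hc & _ & [Hr|Hn]); [destruct (no_ring _ Hr)|].
  destruct Hm as (r & _ & Hr). revert n Hr.
  induction r as [r IH] using lt_wf_ind. intros n Hr.
  assert (r <= d /\ n <= d) as [Lr Ln].
  { apply inset_le in Hr. pose proof (cpair_le_l r n). pose proof (cpair_le_r r n). lia. }
  destruct (Hn r Lr n Ln Hr) as [(w & _ & Hw)|(y & _ & (r1 & _ & L1 & Hr1) & w & _ & Hw)].
  - apply ThC_spec, Hth. eauto.
  - assert (He : edgeC axC L E y n) by (apply Hed; eauto).
    destruct He as [He|(_ & _ & He)].
    + exact (theorem_edge _ _ He (IH r1 L1 y Hr1)).
    + apply Inst2C_Prov in He as ->. eexists. split; [|reflexivity].
      apply Prv_of_PA, (Prov_true d). apply normal_good; [exact Hn|exact Hc|].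
      exact (inrank_mem _ _ _ Hr1).
Qed.

Lemma Prov_nec p : Prv T p -> PA (Pr_at Prov (fcode p)).
Proof.
  intros H. assert (Hx : ThC axC (fcode p)) by (apply ThC_spec; eauto).
  apply Hth in Hx as [w Hw]. destruct (normal_stage_ex th ed E w _ Hw) as (d & Hn & Hc & Hm).
  apply (Prov_true d). now apply normal_good.
Qed.

Lemma Prov_ProvPred : ProvPred T Prov.
Proof.
  split; [apply Prov_bound|]. intros n. split.
  - intros H. apply Prov_good in H as [d H]. exact (good_theorem d n H).
  - intros (p & H & <-). now apply Prov_nec.
Qed.

(** A small witness is judged in the standard model: if good, it makes [n] the code of a theorem,
    hence [m] as well, and PA proves Pr(m) outright. *)
Lemma Prov_edge n m : edgeC axC L E n m -> PA (fimp (Pr_at Prov n) (Pr_at Prov m)).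
Proof.
  intros He. assert (Hw := He). apply Hed in Hw as [w Hw].
  destruct (eps_ex th ed E w n m Hw) as [u Hu].
  assert (Hf : PA (f4 Feps (num u) (num n) (num m) (num E))).
  { assert (Hf : PA (fsubst (numv (u .: n .: m .: E .: fun _ => 0)) Feps)).
    { refine (proj1 (Delta0_decide Feps Deps _) _). now apply Eeps. }
    unfold f4. erewrite fsubst_ext_bound; [exact Hf|exact Beps|].
    intros [|[|[|[|k]]]] Hk; try reflexivity. lia. }
  (* Beyond this bound [u], [n] and [m] are in the range of the quantifiers of [transfer], and the
     witness for [n] serves for [m]. *)
  apply (Prov_elim n (u + n + m)).
  - intros j _ Hg. apply good_theorem in Hg.
    assert (Hm : exists q, Prv T q /\ fcode q = m).
    { destruct He as [He|(_ & _ & He)].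
      - exact (theorem_edge _ _ He Hg).
      - apply Inst2C_Prov in He as ->. destruct Hg as (p & Hp & <-).
        eexists. split; [|reflexivity]. now apply Prv_of_PA, Prov_nec. }
    destruct Hm as (q & Hq & <-). now apply Prov_nec.
  - rewrite Prov_at. change (fshift (fex ?p)) with (fex (fsubst (up (fun n => tvar (S n))) p)).
    apply (nd_ex _ _ (tvar 0)). rewrite !stage_subst by assumption.
    cbn [tsubst up inst0]. rewrite !tsubst_num.
    apply (@stage_transfer Fmem Feps Fring Fact Bmem Beps _ (tvar 0) E u n m (u + n + m) Hf); try lia.
    + apply nd_self.
    + apply nd_weak1, nd_self.
Qed.

Lemma Prov_mono p q : Prv T (fimp p q) ->
  PA (fimp (Pr_at Prov (fcode p)) (Pr_at Prov (fcode q))).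
Proof.
  intros H. apply Prov_edge. left. apply ThC_spec. exists (fimp p q). split; [exact H|reflexivity].
Qed.

Lemma fcode_tag p : exists t r, t <= 3 /\ fcode p = cpair t r.
Proof. destruct p; cbn [fcode]; do 2 eexists; (split; [|reflexivity]); lia. Qed.

Lemma fcode_not_junk p i : fcode p <> cpair 4 i.
Proof.
  destruct (fcode_tag p) as (t & r & Ht & ->). intros H. apply cpair_inj in H as [H _]. lia.
Qed.

Lemma Prov_four p : L = MNF ->
  PA (fimp (Pr_at Prov (fcode p)) (Pr_at Prov (fcode (Pr_at Prov (fcode p))))).
Proof.
  intros HL. apply Prov_edge. right. split; [exact HL|]. split; [apply fcode_tag|].
  now apply Inst2C_Prov.
Qed.

Lemma Prov_CondM : CondM T Prov.
Proof. intros p q H. now apply Prv_of_PA, Prov_mono. Qed.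

(** * Arithmetical soundness *)

(** Kalmár's argument for the completeness of propositional logic: from the literals of its atoms PA
    derives each formula or its negation, and case distinctions then remove the literals. *)
Definition lit (f : nat -> form) (v : mform -> bool) (a : mform) : form :=
  if mtv v a then interp Prov f a else fneg (interp Prov f a).

Fixpoint atoms (a : mform) : list mform :=
  match a with
  | mbot => []
  | mimp a b => atoms a ++ atoms b
  | _ => [a]
  end.

Lemma lit_atoms f v G a :
  (forall x, In x (atoms a) -> ndp G (lit f v x)) -> ndp G (lit f v a).
Proof.
  induction a as [n| |a IHa b IHb|a _]; intros H; cbn [atoms] in H.
  - apply H. now left.
  - apply (pa_num_neq G 0 1). lia.
  - specialize (IHa (fun x Hx => H x (in_or_app _ _ _ (or_introl Hx)))).
    specialize (IHb (fun x Hx => H x (in_or_app _ _ _ (or_intror Hx)))).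
    unfold lit in *; cbn [mtv interp].
    destruct (mtv v a), (mtv v b); cbn [implb].
    + now apply nd_imp, nd_weak1.
    + apply nd_imp. eapply nd_mp; [apply nd_weak1, IHb|].
      eapply nd_mp; [apply nd_self|apply nd_weak1, IHa].
    + now apply nd_imp, nd_weak1.
    + apply nd_imp. eapply nd_absurd; [apply nd_weak1, IHa|apply nd_self].
  - apply H. now left.
Qed.

Lemma atoms_atomic a x v : In x (atoms a) -> mtv v x = v x.
Proof.
  induction a; cbn; try (intros [<-|[]]; reflexivity); [intros []|].
  intros H. apply in_app_or in H as [H|H]; auto.
Qed.

Lemma mform_eq_dec (a b : mform) : {a = b} + {a <> b}.
Proof. decide equality; apply Nat.eq_dec. Defined.

Lemma nd_all_cases f q l : (forall x v, In x l -> mtv v x = v x) -> forall G,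
  (forall v, ndp (map (lit f v) l ++ G) q) -> ndp G q.
Proof.
  induction l as [|x l IH]; intros Hat G H; [exact (H (fun _ => true))|].
  apply IH; [intros y v Hy; apply Hat; now right|]. intros v.
  assert (U : forall b, ndp ((if b : bool then interp Prov f x else fneg (interp Prov f x))
    :: map (lit f v) l ++ G) q).
  (* The valuation is overridden at [x], so a repeated occurrence of [x] in the list yields the same
     literal again. *)
  { intros b. set (v' := fun y => if mform_eq_dec y x then b else v y).
    assert (Hv' : lit f v' x = if b then interp Prov f x else fneg (interp Prov f x)).
    { unfold lit. rewrite Hat by now left. unfold v'. destruct mform_eq_dec; tauto. }
    eapply nd_weak; [|exact (H v')]. intros y Hy. cbn [map app] in Hy. rewrite Hv' in Hy.
    destruct Hy as [Hy|Hy]; [now left|]. apply in_app_or in Hy as [Hy|Hy].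
    - apply in_map_iff in Hy as (z & <- & Hz).
      destruct (classic (z = x)) as [->|Nz]; [left; now rewrite Hv'|].
      right. apply in_or_app. left. apply in_map_iff. exists z. split; [|exact Hz].
      unfold lit. rewrite !Hat by now right. unfold v'.
      destruct mform_eq_dec; [tauto|reflexivity].
    - right. apply in_or_app. now right. }
  apply (nd_case _ (interp Prov f x)); [exact (U true)|exact (U false)].
Qed.

Lemma taut_PA f a : taut a -> PA (interp Prov f a).
Proof.
  intros H. apply (nd_all_cases f _ (atoms a) (fun x v => atoms_atomic a x v) []). intros v.
  assert (L0 : ndp (map (lit f v) (atoms a) ++ []) (lit f v a)).
  { apply lit_atoms. intros x Hx. apply nd_hyp, in_or_app. left. now apply in_map. }
  unfold lit in L0 at 2. now rewrite H in L0.
Qed.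

Lemma arithmetical_soundness A f : MPrv L A -> PA (interp Prov f A).
Proof.
  induction 1 as [a H|a b _ IH1 _ IH2|a _ IH|a b _ IH|a HL].
  - now apply taut_PA.
  - exact (prv_mp _ _ _ IH1 IH2).
  - now apply Prov_nec, Prv_of_PA.
  - now apply Prov_mono, Prv_of_PA.
  - now apply Prov_four.
Qed.

(** * Arithmetical completeness *)

(* The number [cpair 4 i] codes no formula. *)
Definition junk (i : nat) : form := Pr_at Prov (cpair 4 i).
Notation I := (interp Prov junk).

Definition atom_code (a : mform) : nat :=
  match a with
  | mvar i => cpair 4 i
  | mbox a => fcode (I a)
  | _ => 0
  end.

Fixpoint mboxes (k : nat) (a : mform) : mform :=
  match k with 0 => a | S k => mbox (mboxes k a) end.

(** * A ringing stage from a modal countermodel *)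

Section Refutation.
Context (A : mform) (v : mform -> bool).
Context (HvA : mtv v A = false) (HTA : Prv T (I A)).
Context (Ob : forall D, In (mbox D) (atoms A) -> v (mbox D) = false ->
  ~ Prv T (I D) /\
  forall C, In (mbox C) (atoms A) -> v (mbox C) = true ->
    ~ Prv T (I (mimp C D)) /\ (L = MNF -> ~ Prv T (I (mimp (mbox C) D)))).
Context (s : nat)
  (Hs : forall i, inset s i <-> In i (map (fun x => cpair (Nat.b2n (v x)) (atom_code x)) (atoms A))).

Lemma assigned b n : inrank s (Nat.b2n b) n <->
  exists x, In x (atoms A) /\ v x = b /\ atom_code x = n.
Proof.
  unfold inrank. rewrite Hs, in_map_iff. split.
  - intros (x & H & Hx). apply cpair_inj in H as [H1 H2]. exists x.
    split; [exact Hx|]. split; [|exact H2]. destruct (v x), b; auto; discriminate H1.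
  - intros (x & Hx & <- & <-). eauto.
Qed.

Lemma atoms_shape B x : In x (atoms B) -> (exists i, x = mvar i) \/ exists D, x = mbox D.
Proof.
  induction B; cbn; try (intros [<-|[]]; eauto); [intros []|].
  intros H. apply in_app_or in H as [H|H]; auto.
Qed.

Lemma evalC_interp B : incl (atoms B) (atoms A) ->
  evalC E s (cpair (Nat.b2n (mtv v B)) (fcode (I B))).
Proof.
  assert (Hat : forall x, In x (atoms A) -> evalC E s (cpair (Nat.b2n (v x)) (fcode (I x)))).
  { intros x Hx. apply ind_base. right.
    exists (Nat.b2n (v x)), (atom_code x), (fcode (I x)). split; [reflexivity|].
    split; [apply (assigned (v x)); eauto|]. apply Inst2C_Prov.
    destruct (atoms_shape _ _ Hx) as [[i ->]|[D ->]]; reflexivity. }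
  induction B as [n| |B IHB C IHC|B _]; intros Hi; cbn [atoms] in Hi.
  - apply Hat, Hi. now left.
  - apply ind_base. left. reflexivity.
  - specialize (IHB (fun x Hx => Hi x (in_or_app _ _ _ (or_introl Hx)))).
    specialize (IHC (fun x Hx => Hi x (in_or_app _ _ _ (or_intror Hx)))).
    cbn [mtv interp fcode].
    destruct (mtv v B), (mtv v C); cbn [implb Nat.b2n] in *.
    + eapply ind_rule; [|exact IHC|exact IHC]. do 2 eexists. left. split; [reflexivity|]. now right.
    + eapply ind_rule; [|exact IHB|exact IHC]. do 2 eexists. right. repeat split.
    + eapply ind_rule; [|exact IHC|exact IHC]. do 2 eexists. left. split; [reflexivity|]. now right.
    + eapply ind_rule; [|exact IHB|exact IHB]. do 2 eexists. left. split; [reflexivity|]. now left.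
  - apply Hat, Hi. now left.
Qed.

(** Each formula reached remembers a true box [mbox C] it came from; [k] counts the edges into Pr on
    the way. Implication edges compose with the implication already obtained, and an edge from p to
    Pr(p) adds a box on its left by condition M. Numbers interpreting variables have no outgoing
    edges. *)
Lemma generated_shape l x : generated ed l E (inrank s 1) x ->
  (exists i, x = cpair 4 i /\ inrank s 1 x) \/
  exists p, fcode p = x /\
    (Prv T p \/ exists C k, In (mbox C) (atoms A) /\ v (mbox C) = true /\ (k = 0 \/ L = MNF) /\
       Prv T (fimp (I (mboxes k C)) p)).
Proof.
  induction 1 as [x [_ H]|x y z (-> & _ & _ & w & _ & Hw) _ IH _ _].
  - assert (H' := H). apply (assigned true) in H' as (a & Ha & Hva & <-).
    destruct (atoms_shape _ _ Ha) as [[i ->]|[C ->]]; [left; exists i; auto|].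
    right. exists (I C). split; [reflexivity|]. right. exists C, 0.
    split; [exact Ha|]. split; [exact Hva|]. split; [now left|].
    apply (nd_self (Ax := T) []).
  - assert (He : edgeC axC L E y x) by (apply Hed; eauto). right.
    destruct He as [He|(HL & (t & r & Ht & Ey) & He)].
    + apply ThC_spec in He as (c & Hc & Ec). unfold impC in Ec.
      destruct c as [| |c1 c2|]; cbn [fcode] in Ec; apply cpair_inj in Ec as [E1 E2]; try discriminate E1.
      apply cpair_inj in E2 as [E2 E3]. exists c2. split; [exact E3|].
      destruct IH as [(i & Ei & _)|(p & Ep & Hp)].
      { rewrite <- E2 in Ei. now apply fcode_not_junk in Ei. }
      rewrite <- E2 in Ep. apply fcode_inj in Ep as ->.
      destruct Hp as [Hp|(C & k & H1 & H2 & H3 & H4)].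
      * left. exact (prv_mp _ _ _ Hc Hp).
      * right. exists C, k. do 3 (split; [assumption|]).
        apply (nd_imp (Ax := T) []). eapply nd_mp_Prv; [exact Hc|]. apply nd_unimp. exact H4.
    + apply Inst2C_Prov in He as ->. eexists. split; [reflexivity|].
      destruct IH as [(i & Ei & _)|(p & <- & Hp)].
      { rewrite Ey in Ei. apply cpair_inj in Ei as [-> _]. lia. }
      destruct Hp as [Hp|(C & k & H1 & H2 & H3 & H4)].
      * left. now apply Prv_of_PA, Prov_nec.
      * right. exists C, (S k). do 2 (split; [assumption|]). split; [now right|].
        exact (Prov_CondM _ _ H4).
Qed.

(** Collapses the boxes collected along the edges to one, so the obligations only have to speak of
    [C] and [mbox C]. *)
Lemma four_iter k C : L = MNF -> MPrv L (mimp (mbox C) (mboxes (S k) C)).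
Proof.
  intros HL. induction k as [|k IH].
  - apply m_taut. intros u; cbn. now destruct (u (mbox C)).
  - assert (H4 := m_four L C HL). apply m_rm in IH. cbn [mboxes] in *.
    refine (m_mp _ _ _ (m_mp _ _ _ (m_taut _ _ _) H4) IH).
    intros u; cbn. now destruct (u (mbox C)), (u (mbox (mbox C))), (u (mbox (mbox (mboxes k C)))).
Qed.

Lemma refutation_ring : False.
Proof.
  assert (Hr : refutedC axC E s).
  { exists (fcode (I A)). split; [apply ThC_spec; eauto|].
    pose proof (evalC_interp A (incl_refl _)) as H. now rewrite HvA in H. }
  apply Hee in Hr as [w Hw].
  (* This level bounds the numbers assigned by [s] and, as the stage is at least as large, brings
     both [s] and the witness [w] of the refutation below [d]. *)
  destruct (generated_stage_ex th ed E (s + w) (inrank s 1)) as (d & Hd & Hc & Hm).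
  apply (no_ring d). split; [exact Hc|]. exists s. split; [lia|].
  split; [exists w; split; [lia|exact Hw]|]. intros n _. split.
  - intros Hn. apply Hm, ind_base. split; [|exact Hn].
    apply inset_le in Hn. pose proof (cpair_le_r 1 n). lia.
  - intros Hn. apply (assigned false) in Hn as (x & Hx & Hvx & <-).
    assert (K : forall p, fcode p = atom_code x -> exists D, x = mbox D /\ p = I D).
    { intros p Ep. destruct (atoms_shape _ _ Hx) as [[i ->]|[D ->]].
      - now apply fcode_not_junk in Ep.
      - apply fcode_inj in Ep. eauto. }
    split.
    + rewrite Hm. intros Hg. apply generated_shape in Hg as [(i & Ei & Hg)|(p & Ep & Hp)].
      (* Such a number enters the closure only by being assigned true, and different variables have
         different numbers. *)
      * apply (assigned true) in Hg as (y & Hy & Hvy & Ey).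
        rewrite Ei in Ey.
        destruct (atoms_shape _ _ Hx) as [[j ->]|[D ->]]; [|now apply fcode_not_junk in Ei].
        destruct (atoms_shape _ _ Hy) as [[k ->]|[D ->]]; [|now apply fcode_not_junk in Ey].
        cbn [atom_code] in Ei, Ey. apply cpair_inj in Ei as [_ ->]. apply cpair_inj in Ey as [_ ->]. congruence.
      * apply K in Ep as (D & -> & ->). destruct (Ob D Hx Hvx) as [O1 O2].
        destruct Hp as [Hp|(C & k & H1 & H2 & H3 & H4)]; [exact (O1 Hp)|].
        destruct (O2 C H1 H2) as [O3 O4]. destruct k as [|k]; [exact (O3 H4)|].
        destruct H3 as [H3|HL]; [discriminate H3|]. apply (O4 HL).
        pose proof (Prv_of_PA _ (arithmetical_soundness _ junk (four_iter k C HL))) as H5.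
        apply (nd_imp (Ax := T) []). eapply nd_mp_Prv; [exact H4|]. apply nd_unimp. exact H5.
    (* A normal closed stage holds only theorems, and no variable's number codes a formula; so the
       atom is a box [mbox D] with [I D] provable in T, against the obligation for [D]. *)
    + intros d' _ _ (Hc' & Hn' & Hm').
      destruct (good_theorem d' _ (normal_good _ _ Hn' Hc' Hm')) as (p & Hp & Ep).
      apply K in Ep as (D & -> & ->). exact (proj1 (Ob D Hx Hvx) Hp).
Qed.

End Refutation.

(** * Completeness by induction on modal depth *)

Definition conservative (A : mform) : Prop := Prv T (I A) -> MPrv L A.

(** The provable formulas in [H] become antecedents of [A]; if no valuation served, the resulting
    implication would be a tautology and [A] provable. *)
Lemma countermodel A (H : list mform) : (forall h, In h H -> MPrv L h) -> ~ MPrv L A ->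
  exists v, (forall h, In h H -> mtv v h = true) /\ mtv v A = false.
Proof.
  revert A; induction H as [|h H IH]; intros A HL HA.
  - apply NNPP. intros N. apply HA, m_taut. intros v.
    destruct (mtv v A) eqn:Ev; [reflexivity|]. exfalso. apply N. exists v. split; [intros h []|exact Ev].
  - destruct (IH (mimp h A)) as (v & Hv & HvA).
    + intros k Hk. apply HL. now right.
    + intros N. apply HA. eapply m_mp; [exact N|]. apply HL. now left.
    + cbn in HvA. exists v. destruct (mtv v h) eqn:Eh, (mtv v A) eqn:EA; try discriminate HvA.
      split; [|reflexivity]. intros k [<-|Hk]; auto.
Qed.

Lemma conservative_step A :
  (forall v, mtv v A = false -> forall D, In (mbox D) (atoms A) -> v (mbox D) = false ->
     conservative D /\ forall C, In (mbox C) (atoms A) ->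
       conservative (mimp C D) /\ (L = MNF -> conservative (mimp (mbox C) D))) ->
  conservative A.
Proof.
  intros Hyp HTA. apply NNPP. intros HA.
  (* The atoms themselves account for necessitation, the implications between them for
     monotonicity. *)
  set (cands := atoms A ++ flat_map (fun x => map (mimp x) (atoms A)) (atoms A)).
  destruct (sublist_ex (MPrv L) cands) as [H HH].
  destruct (countermodel A H) as (v & Hv & HvA); [intros h Hh; now apply HH|exact HA|].
  assert (Hv' : forall h, In h cands -> MPrv L h -> mtv v h = true).
  { intros h Hh Hp. now apply Hv, HH. }
  destruct (inset_of_list (map (fun x => cpair (Nat.b2n (v x)) (atom_code x)) (atoms A))) as [s Hs].
  apply (refutation_ring A v HvA HTA) with (s := s); [|exact Hs].
  intros D HD HvD. destruct (Hyp v HvA D HD HvD) as [CD CC].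
  assert (N1 : ~ MPrv L (mbox D)).
  { intros N. apply Hv' in N; [|apply in_or_app; now left]. cbn in N. congruence. }
  split; [intros N; apply N1, m_nec, CD, N|].
  intros C HC HvC. destruct (CC C HC) as [C1 C2].
  assert (N2 : ~ MPrv L (mimp (mbox C) (mbox D))).
  { intros N. apply Hv' in N.
    - cbn in N. rewrite HvC, HvD in N. discriminate N.
    - apply in_or_app. right. apply in_flat_map. exists (mbox C). split; [exact HC|].
      now apply in_map. }
  split.
  - intros N. apply N2, m_rm, C1, N.
  (* RM turns the implication from [mbox C] to [D] into one from [mbox (mbox C)] to [mbox D], and
     axiom 4 removes the extra box. *)
  - intros HL N. apply N2. apply (C2 HL) in N. apply m_rm in N.
    refine (m_mp _ _ _ (m_mp _ _ _ (m_taut _ _ _) (m_four L C HL)) N).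
    intros u; cbn. now destruct (u (mbox C)), (u (mbox (mbox C))), (u (mbox D)).
Qed.

Fixpoint mdepth (a : mform) : nat :=
  match a with
  | mimp a b => Nat.max (mdepth a) (mdepth b)
  | mbox a => S (mdepth a)
  | _ => 0
  end.

Lemma mdepth_atoms A D : In (mbox D) (atoms A) -> mdepth D < mdepth A.
Proof.
  induction A; cbn; try (intros [H|[]]; inversion H; lia); [intros []|].
  intros H. apply in_app_or in H as [H|H]; [apply IHA1 in H|apply IHA2 in H]; lia.
Qed.

(* [mbox C] is true in every countermodel of [mimp (mbox C) B], so only the boxes of [B] give rise to
   obligations; this makes the depth of [B] decrease although that of [mbox C] need not. *)
Lemma conservative_box_imp n : (forall A, mdepth A < n -> conservative A) ->
  forall k C B, mdepth C < n -> mdepth B < n -> mdepth B <= k -> conservative (mimp (mbox C) B).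
Proof.
  intros Hn k. induction k as [k IH] using lt_wf_ind. intros C B HC HB Hk.
  apply conservative_step. intros v Hv D HD HvD. cbn in Hv, HD.
  destruct HD as [HD|HD].
  { rewrite HD, HvD in Hv. discriminate Hv. }
  apply mdepth_atoms in HD. split; [apply Hn; lia|].
  intros C' HC'. assert (mdepth C' < n).
  { destruct HC' as [HC'|HC']; [injection HC' as <-; exact HC|]. apply mdepth_atoms in HC'. lia. }
  split; [apply Hn; cbn; lia|]. intros _. apply (IH (mdepth D)); lia.
Qed.

(** [D] and [mimp C D] have smaller depth than [A], but [mimp (mbox C) D] may be as deep as [A];
    that case is left to [conservative_box_imp]. *)
Lemma conservative_all A : conservative A.
Proof.
  assert (H : forall n A, mdepth A < n -> conservative A).
  { induction n as [|n IH]; [lia|]. intros B HB. apply conservative_step.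
    intros v _ D HD _. apply mdepth_atoms in HD. split; [apply IH; lia|].
    intros C HC. apply mdepth_atoms in HC. split; [apply IH; cbn; lia|].
    intros _. apply (conservative_box_imp n IH (mdepth D)); lia. }
  exact (H _ A (le_n _)).
Qed.

Lemma Prov_complete :
  Sigma1 Prov /\ ProvPred T Prov /\ CondM T Prov /\
  (forall (A : mform) (f : nat -> form), arith_interp f -> MPrv L A -> PA (interp Prov f A)) /\
  (exists f : nat -> form, arith_interp f /\ forall A : mform, MPrv L A <-> Prv T (interp Prov f A)).
Proof.
  split; [apply Prov_Sigma1|]. split; [apply Prov_ProvPred|]. split; [apply Prov_CondM|]. split.
  - intros A f _. apply arithmetical_soundness.
  - exists junk. split; [intros n; apply Prov_sentence|]. intros A. split.
    + intros H. now apply Prv_of_PA, arithmetical_soundness.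
    + apply conservative_all.
Qed.

End Predicate.

Theorem theorem4p3 (T : form -> Prop)
  (HPR : PR_axiomatized T) (Hext : extends_PA T) (Hcon : consistent T)
  (L : logic) :
  exists Pr : form,
    Sigma1 Pr /\ ProvPred T Pr /\ CondM T Pr /\
    (forall (A : mform) (f : nat -> form),
        arith_interp f -> MPrv L A -> PA (interp Pr f A)) /\
    (exists f : nat -> form, arith_interp f /\
        forall A : mform, MPrv L A <-> Prv T (interp Pr f A)).
Proof.
  destruct HPR as (g & Hg & Hax).
  set (axC n := g [n] = 0).
  assert (Sax : S1 (fun e => axC (e 0))).
  { unfold axC. apply S1_eq; [|apply F1_const].
    apply (F1_PRf 1 g Hg [fun e => e 0]); [reflexivity|]. constructor; [apply F1_var|constructor]. }
  destruct (S1_staged1 (ThC axC) (S1_ThC axC _ Sax (F1_var 0))) as (th & Dth & Hth).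
  destruct (S1_staged3 (edgeC axC L) (S1_edgeC axC L Sax)) as (ed & Ded & Hed).
  destruct (S1_staged2 (refutedC axC) (S1_refutedC axC Sax)) as (ee & Dee & Hee).
  destruct (D0_formula 2 _ (D0_mem _ _ (Tm_var 0) (Tm_var 1))) as (Fmem & Dmem & Bmem & Emem);
    [reflexivity|].
  destruct (D0_formula 4 _ (D0_eps th ed Dth Ded _ _ _ _ (Tm_var 0) (Tm_var 1) (Tm_var 2) (Tm_var 3)))
    as (Feps & Deps & Beps & Eeps); [reflexivity|].
  destruct (D0_formula 2 _ (D0_ring th ed ee Dth Ded Dee _ _ (Tm_var 0) (Tm_var 1)))
    as (Fring & Dring & Bring & Ering); [reflexivity|].
  destruct (D0_formula 2 _ (D0_active th ed ee Dth Ded Dee _ _ (Tm_var 0) (Tm_var 1)))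
    as (Fact & Dact & Bact & Eact); [reflexivity|].
  exists (Prov Fmem Feps Fring Fact (fcode (preds Fmem Feps Fring Fact))).
  apply (Prov_complete T L axC Hax Hext Hcon th ed ee Hth Hed Hee); try assumption. reflexivity.
Qed.
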